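(* Let $\mathcal H$ be a simple graph on $2n$ vertices, without isolated vertices, which has a minimal vertex cover of $n$ elements. Then $\mathcal H$ is a Cohen-Macaulay graph if and only if $\mathcal H$ is a twin-free very well-covered graph.
   Context: Let $k$ be a field and $R$ the polynomial ring over $k$ whose variables are the vertices of $\mathcal H$. The edge ideal $I(\mathcal H)\subseteq R$ is generated by the products $xy$ where $\{x,y\}$ runs over the edges of $\mathcal H$. $\mathcal H$ is called Cohen-Macaulay (over $k$) if $R/I(\mathcal H)$ is a Cohen-Macaulay ring, i.e. $\operatorname{depth} R/I(\mathcal H)=\dim R/I(\mathcal H)$. A vertex cover is a set of vertices meeting every edge; a minimal vertex cover is one minimal with respect to inclusion. A graph is very well-covered if all its minimal vertex covers contain exactly half of the vertices. Two distinct vertices are twin if they have the same open neighborhood; a graph is twin-free if it has no pair of twin vertices. *)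

(* Defs.v *)
From HB Require Import structures.
From mathcomp Require Import all_boot all_order all_algebra.
From mathcomp Require Import boolp classical_sets.
From mathcomp Require Import mpoly.

Set Implicit Arguments.
Unset Strict Implicit.
Unset Printing Implicit Defensive.

Import GRing.Theory.

Local Open Scope ring_scope.
Local Open Scope quotient_scope.

Section CommutativeAlgebra.

Variable A : comNzRingType.

Definition ideal_gen (S : set A) : set A :=
  [set x | exists2 s : seq (A * A),
     (forall p, p \in s -> S p.2) & x = \sum_(p <- s) p.1 * p.2].

(* [prime_idealr A] consists of boolean predicates; classically every subset
   of [A] is one, so these are all the prime ideals of [A]. *)
Definition prime_chain (d : nat) (P : nat -> prime_idealr A) : Prop :=
  forall i, (i < d)%N ->
    (forall x, x \in P i -> x \in P i.+1) /\
    (exists2 x, x \in P i.+1 & x \notin P i).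

Definition has_krull_dim (d : nat) : Prop :=
  (exists P, prime_chain d P) /\
  (forall d' P, prime_chain d' P -> (d' <= d)%N).

Definition regular_seq (s : seq A) : Prop :=
  (forall i, (i < size s)%N -> forall g,
     ideal_gen [set` take i s] (s`_i * g) -> ideal_gen [set` take i s] g) /\
  ~ ideal_gen [set` s] 1.

Definition has_depth (m : set A) (d : nat) : Prop :=
  (exists s : seq A,
     [/\ regular_seq s, (forall x, x \in s -> m x) & size s = d]) /\
  (forall s : seq A,
     regular_seq s -> (forall x, x \in s -> m x) -> (size s <= d)%N).

End CommutativeAlgebra.

Section EdgeIdeal.

Variables (k : fieldType) (V : finType) (e : rel V).

Definition vertex_ring : comNzRingType := {mpoly k[#|V|]}.

Definition vertex_var (v : V) : vertex_ring := 'X_(enum_rank v).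

Definition edge_monomials : set vertex_ring :=
  [set f | exists x y, e x y /\ f = vertex_var x * vertex_var y].

Definition edge_ideal : {pred vertex_ring} :=
  fun f => `[< ideal_gen edge_monomials f >].

Lemma edge_ideal_closed : idealr_closed edge_ideal.
Proof.
split.
- by apply/asboolP; exists [::] => //; rewrite big_nil.
- apply/negP => /asboolP [s sS].
  move/(congr1 (meval (fun _ => 0 : k))); rewrite rmorph1 rmorph_sum /=.
  rewrite big_seq big1 => [/eqP|p /sS [x [y [_ ->]]]]; first by rewrite oner_eq0.
  by rewrite /vertex_var !rmorphM /= !mevalXU mul0r mulr0.
- move=> a f g /asboolP [s sS ->] /asboolP [t tS ->]; apply/asboolP.
  exists ([seq (a * p.1, p.2) | p <- s] ++ t) => [p|].
    by rewrite mem_cat => /orP [/mapP [q /sS ? ->]|/tS].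
  by rewrite big_cat big_map mulr_sumr; congr (_ + _); apply: eq_bigr => p _;
    rewrite mulrA.
Qed.

HB.instance Definition _ := isIdealr.Build vertex_ring edge_ideal
  edge_ideal_closed.

Definition edge_ring : comNzRingType := {ideal_quot edge_ideal}.

Definition irrelevant_ideal : set edge_ring :=
  ideal_gen [set f | exists v, f = \pi_({ideal_quot edge_ideal}) (vertex_var v)].

(* Depth is taken with respect to the graded maximal ideal, as usual for
   standard graded algebras. *)
Definition Cohen_Macaulay : Prop :=
  exists d, has_depth irrelevant_ideal d /\ has_krull_dim edge_ring d.

End EdgeIdeal.

Section Graphs.

Variables (V : finType) (e : rel V).

Definition vertex_cover (C : {set V}) : bool :=
  [forall x, forall y, e x y ==> (x \in C) || (y \in C)].

Definition minimal_vertex_cover (C : {set V}) : bool := minset vertex_cover C.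

Definition very_well_covered : Prop :=
  forall C : {set V}, minimal_vertex_cover C -> #|V| = (2 * #|C|)%N.

Definition twin (x y : V) : Prop := x <> y /\ (forall z, e x z = e y z).

Definition twin_free : Prop := forall x y, ~ twin x y.

End Graphs.

(* Main.v *)
From HB Require Import structures.
Require Import Defs.
From mathcomp Require Import boolp classical_sets mpoly.
From mathcomp Require Import all_boot all_order all_algebra ring zify.

Set Implicit Arguments.
Unset Strict Implicit.
Unset Printing Implicit Defensive.

Import GRing.Theory.

Local Open Scope ring_scope.

(** Write [R] for the polynomial ring, [I] for the edge ideal, and recall that
    complements of (minimal) vertex covers are (maximal) independent sets. Two
    estimates drive the proof.

    Upper bounds. If [J_0, ..., J_d] is an increasing chain of ideals with
    elements [f_i] of [J_(i+1)] that are nonzerodivisors modulo [J_i], and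
    [J_d] is proper, then the [f_i] are algebraically independent modulo [J_0]:
    in a polynomial relation, divide by the lowest power of [f_0] and reduce
    modulo [J_1] ([regular_chain_free]). Chains of primes and regular sequences
    are both of this shape, and counting the monomials outside [I] bounds
    [d] by the largest size of an independent set ([regular_chain_le]). This
    bounds the Krull dimension and the depth at the same time; conversely the
    primes generated by the vertex covers containing the complement of an
    independent set [S] form a chain of length [#|S|] ([cover_prime_chain]).

    Cohen-Macaulay implies very well-covered and twin-free. A regular sequence
    of length [d] in the irrelevant ideal makes the Koszul cohomology
    [H^j(x_V; R/I)] vanish for [j < d] ([weakly_regular_acyclic]). By the graded
    Nakayama lemma, a variable can be removed from the Koszul complex at the
    cost of one degree ([acyclic_behead]), so [H^j(x_C; R/I) = 0] as soon as
    [#|~: C| + j < d]. If [S] is a maximal independent set, the monomial [x_S]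
    is annihilated by the variables outside [S]; hence [d <= #|S|]
    ([depth_le_maximal_independent]), and with the bound on the dimension all
    maximal independent sets have [d] elements. Very well-covered graphs
    without isolated vertices have a perfect matching [mu] (Hall's theorem,
    [perfect_matching]), and across a matching edge all neighbors of one end
    are adjacent to all neighbors of the other ([matching_edge_join]). For twins
    [p] and [q], choose [S] maximal such that both [p |: S] and [mu p |: S] are
    independent. The vertices outside [S] without neighbor in [S] split into
    the neighbors of [p] and those of [mu p], with all edges between the
    two parts. This disconnection gives a nonzero class in [H^1(x_(~: S); R/I)],
    so [d <= #|S| + 1] ([depth_le_disconnected]); but [S] together with [p] and
    [q] is independent, so [#|S| + 2 <= d].

    Twin-free very well-covered implies Cohen-Macaulay. The differences
    [x_v - x_(mu v)], one for each matching edge, form a regular sequence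
    ([edge_diffs_regular]). To see it, one adds sets [K] of variables to [I] and
    uses the exact sequence relating [R/(J : y)], [R/J] and [R/(J + (y))]
    ([weakly_regular_colon]) with [y = x_(mu v)]: both outer terms are again
    quotients of the same kind with fewer free matching edges, provided that
    [mu v] is the only neighbor of [v] outside [K]. Twin-freeness provides such
    a vertex [v]. *)

(** * Ideals as sets, and weakly regular sequences *)
Section Ideals.

Variable R : comNzRingType.
Implicit Types (J : set R) (s : seq R).

Definition is_ideal J : Prop :=
  [/\ J 0, forall a b, J a -> J b -> J (a + b) & forall r a, J a -> J (r * a)].

Lemma ideal0 J : is_ideal J -> J 0. Proof. by case. Qed.

Lemma idealD J a b : is_ideal J -> J a -> J b -> J (a + b).
Proof. by case=> _ + _; apply. Qed.

Lemma idealMl J r a : is_ideal J -> J a -> J (r * a).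
Proof. by case=> _ _; apply. Qed.

Lemma idealN J a : is_ideal J -> J a -> J (- a).
Proof. by move=> ? ?; rewrite -mulN1r; apply: idealMl. Qed.

Lemma idealB J a b : is_ideal J -> J a -> J b -> J (a - b).
Proof. by move=> ? ? ?; apply: idealD => //; apply: idealN. Qed.

Definition adjoin J (a : R) : set R :=
  [set x | exists2 j, J j & exists r, x = j + r * a].

Definition colon J (y : R) : set R := [set x | J (y * x)].

Lemma sub_adjoin J a x : J x -> adjoin J a x.
Proof. by exists x => //; exists 0; rewrite mul0r addr0. Qed.

Lemma mem_adjoin J a : is_ideal J -> adjoin J a a.
Proof. by move=> /ideal0; exists 0 => //; exists 1; rewrite mul1r add0r. Qed.

Lemma adjoin_ideal J a : is_ideal J -> is_ideal (adjoin J a).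
Proof.
move=> JI; split.
- by apply: sub_adjoin; apply: ideal0.
- move=> _ _ [j Jj [r ->]] [j' Jj' [r' ->]]; exists (j + j').
    exact: idealD.
  by exists (r + r'); rewrite mulrDl addrACA.
- move=> c _ [j Jj [r ->]]; exists (c * j); first exact: idealMl.
  by exists (c * r); rewrite mulrDr mulrA.
Qed.

Lemma adjoinC J a b : adjoin (adjoin J a) b = adjoin (adjoin J b) a.
Proof.
by apply/seteqP; split=> _ [_ [j Jj [r ->]] [r' ->]];
  (eexists; last by [exists r; rewrite addrAC]); exists j => //; exists r'.
Qed.

Lemma ideal_gen_ideal (S : set R) : is_ideal (ideal_gen S).
Proof.
split=> [|_ _ [s sS ->] [t tS ->]|r _ [s sS ->]].
- by exists [::] => //; rewrite big_nil.
- exists (s ++ t) => [p|]; last by rewrite big_cat.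
  by rewrite mem_cat => /orP[/sS|/tS].
- exists [seq (r * p.1, p.2) | p <- s] => [p /mapP[q /sS ? ->] //|].
  by rewrite big_map mulr_sumr; apply: eq_bigr => p _; rewrite mulrA.
Qed.

Lemma ideal_gen_sub (S L : set R) : is_ideal L ->
  (forall a, S a -> L a) -> forall a, ideal_gen S a -> L a.
Proof.
move=> LI sSL _ [s sS ->]; rewrite big_seq; apply: big_ind.
- exact: ideal0 LI.
- by move=> a b; apply: idealD LI.
by move=> p /sS /sSL; apply: idealMl LI.
Qed.

Lemma ideal_gen_mem (S : set R) a : S a -> ideal_gen S a.
Proof.
move=> Sa; exists [:: (1, a)] => [p|]; last by rewrite big_seq1 mul1r.
by rewrite inE => /eqP->.
Qed.

Lemma prime_ideal_is_ideal (P : prime_idealr R) :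
  is_ideal [set a | a \in P].
Proof.
split=> [|a b|c a] /=; [exact: idealr0|exact: rpredD|exact: idealMr].
Qed.

Lemma adjoin_congr J a b : is_ideal J -> J (a - b) ->
  adjoin J a = adjoin J b.
Proof.
move=> JI Jab; have Jba : J (b - a) by rewrite -opprB; apply: idealN.
have sub c d : J (c - d) -> forall y, adjoin J c y -> adjoin J d y.
  move=> Jcd _ [j Jj [r ->]]; exists (j + r * (c - d)).
    by apply: idealD => //; apply: idealMl.
  by exists r; ring.
by apply/seteqP; split; apply: sub.
Qed.

Lemma adjoinN J a : adjoin J (- a) = adjoin J a.
Proof.
apply/seteqP; split=> _ [j Jj [r ->]]; exists j => //; exists (- r);
by rewrite ?mulrNN // mulrN mulNr.
Qed.

Definition adjoins J s : set R := foldl adjoin J s.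

Lemma adjoins_sub J J' s : is_ideal J' ->
  (forall x, J x -> J' x) -> (forall a, a \in s -> J' a) ->
  forall x, adjoins J s x -> J' x.
Proof.
move=> J'I; elim: s J => [|a s IHs] J //= sJJ' s_J'.
apply: IHs => [_ [j Jj [r ->]]|b bs]; last by apply: s_J'; rewrite inE bs orbT.
apply: idealD => //; first exact: sJJ'.
by apply: idealMl => //; apply: s_J'; rewrite mem_head.
Qed.

Lemma adjoins_ideal J s : is_ideal J -> is_ideal (adjoins J s).
Proof. by elim: s J => //= a s IHs J /(adjoin_ideal a); apply: IHs. Qed.

Lemma sub_adjoins J s x : J x -> adjoins J s x.
Proof. by elim: s J => //= a s IHs J /(sub_adjoin a); apply: IHs. Qed.

Lemma mem_adjoins J s a : is_ideal J -> a \in s -> adjoins J s a.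
Proof.
elim: s J => //= b s IHs J JI; rewrite inE => /orP[/eqP<-|a_s].
  by apply: sub_adjoins; apply: mem_adjoin.
by apply: IHs => //; apply: adjoin_ideal.
Qed.

Lemma adjoins_mono J J' s : is_ideal J' -> (forall x, J x -> J' x) ->
  forall x, adjoins J s x -> adjoins J' s x.
Proof.
move=> J'I sJJ'; apply: adjoins_sub; first exact: adjoins_ideal.
  by move=> x /sJJ'; apply: sub_adjoins.
by move=> a; apply: mem_adjoins.
Qed.

Fixpoint weakly_regular J s : Prop :=
  if s is a :: s' then
    (forall g, J (a * g) -> J g) /\ weakly_regular (adjoin J a) s'
  else True.

(** This is regularity on the middle term of the exact sequence
    [0 -> R/(J : y) -> R/J -> R/(J + (y)) -> 0], which stays exact after dividing
    by [a] because [a] is regular on the third term. *)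
Lemma weakly_regular_colon J y s : is_ideal J ->
  weakly_regular (colon J y) s -> weakly_regular (adjoin J y) s ->
  weakly_regular J s.
Proof.
elim: s J => //= a s IHs J JI [reg_colon wcolon] [reg_adj wadj]; split.
  move=> g Jag; have [j Jj [r def_g]] := reg_adj g (sub_adjoin _ Jag).
  rewrite def_g; apply: idealD => //; rewrite mulrC; apply: reg_colon.
  rewrite /colon /=.
  have -> : y * (a * r) = a * g - a * j by rewrite def_g; ring.
  by apply: idealB => //; apply: idealMl.
apply: IHs; first exact: adjoin_ideal.
  suff <- : adjoin (colon J y) a = colon (adjoin J a) y by [].
  apply/seteqP; split=> g.
    move=> [j Jyj [r ->]]; exists (y * j) => //; exists (y * r).
    by rewrite mulrDr mulrA.
  move=> [j Jj [r def_yg]].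
  have [|j' Jj' [r' def_r]] := reg_adj r.
    exists (- j); first exact: idealN.
    by exists g; rewrite [g * y]mulrC def_yg; ring.
  exists (g - r' * a); last by exists r'; rewrite subrK.
  rewrite /colon /=.
  have -> : y * (g - r' * a) = j + a * j' by
    rewrite mulrBr def_yg def_r; ring.
  by apply: idealD => //; apply: idealMl.
by rewrite adjoinC.
Qed.

Lemma weakly_regularP J s :
  weakly_regular J s <-> forall i, (i < size s)%N -> forall b,
    adjoins J (take i s) (s`_i * b) -> adjoins J (take i s) b.
Proof.
elim: s J => [|a s IHs] J //=; split.
  by move=> [rega /IHs reg_s] [|i] //= /reg_s.
move=> reg; split; first exact: (reg 0%N).
by apply/IHs => i lt_i; apply: (reg i.+1).
Qed.

(** * Koszul cohomology modulo an ideal *)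

(** The Koszul cochain complex, built as an iterated mapping cone: [cochain s j]
    is the term of cohomological degree [j - 1]. The shift makes the term of
    degree [-1], which is zero, available, so that exactness in degree [0] is
    stated as in the other degrees. *)
Fixpoint cochain s (j : nat) : lmodType R :=
  match j, s with
  | 0, _ => 'rV[R]_0
  | j'.+1, [::] => if j' is 0 then R^o else 'rV[R]_0
  | j'.+1, a :: s' => (cochain s' j'.+1 * cochain s' j')%type
  end.

Fixpoint diff s : forall j, cochain s j -> cochain s j.+1 :=
  match s return forall j, cochain s j -> cochain s j.+1 with
  | [::] => fun _ _ => 0
  | a :: s' => fun j =>
    match j return cochain (a :: s') j -> cochain (a :: s') j.+1 with
    | 0 => fun _ => 0
    | j'.+1 => fun f => (diff f.1, a *: f.1 - diff f.2)
    end
  end.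

Fixpoint vals_in J s : forall j, cochain s j -> Prop :=
  match s return forall j, cochain s j -> Prop with
  | [::] => fun j =>
    match j return cochain [::] j -> Prop with
    | 1 => fun f => J f
    | _ => fun _ => True
    end
  | a :: s' => fun j =>
    match j return cochain (a :: s') j -> Prop with
    | 0 => fun _ => True
    | j'.+1 => fun f => vals_in J f.1 /\ vals_in J f.2
    end
  end.

Lemma diff_lin s j c (f g : cochain s j) :
  diff (c *: f + g) = c *: diff f + diff g.
Proof.
elim: s j f g => [|a s IHs] [|j] //= f g; rewrite ?scaler0 ?addr0 //.
rewrite !IHs; congr (_, _); rewrite /= !scalerDr !scalerA [a * c]mulrC scalerN.
by rewrite opprD addrACA.
Qed.

Lemma diff0 s j : diff (0 : cochain s j) = 0.
Proof.
have := diff_lin 1 (0 : cochain s j) 0.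
by rewrite !scale1r addr0 => e; apply: (addrI (diff 0)); rewrite addr0 -e.
Qed.

Lemma diffD s j (f g : cochain s j) : diff (f + g) = diff f + diff g.
Proof. by have := diff_lin 1 f g; rewrite !scale1r. Qed.

Lemma diffZ s j c (f : cochain s j) : diff (c *: f) = c *: diff f.
Proof. by have := diff_lin c f 0; rewrite !addr0 diff0 addr0. Qed.

Lemma diffB s j (f g : cochain s j) : diff (f - g) = diff f - diff g.
Proof. by rewrite diffD -!scaleN1r diffZ. Qed.

Lemma diffN s j (f : cochain s j) : diff (- f) = - diff f.
Proof. by rewrite -sub0r diffB diff0 sub0r. Qed.

Lemma diff_diff s j (f : cochain s j) : diff (diff f) = 0.
Proof.
elim: s j f => [|a s IHs] [|j] //= f.
  by rewrite !diff0 scaler0; congr (_, _); exact: subrr.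
by rewrite diffB diffZ !IHs subr0; congr (_, _); exact: subrr.
Qed.

Lemma vals_inT J s j (f : cochain s j) : (forall x, J x) -> vals_in J f.
Proof. by move=> JT; elim: s j f => [|a s IHs] [|[|j]] //=. Qed.

Lemma vals_in0 J s j : is_ideal J -> vals_in J (0 : cochain s j).
Proof.
by move=> /ideal0 J0; elim: s j => [|a s IHs] [|[|j]] //=; split; apply: IHs.
Qed.

Lemma vals_inD J s j (f g : cochain s j) : is_ideal J ->
  vals_in J f -> vals_in J g -> vals_in J (f + g).
Proof.
move=> JI; elim: s j f g => [|a s IHs] [|[|j]] //=.
- by move=> f g; apply: idealD.
- by move=> f g [? ?] [? ?]; split; apply: IHs.
- by move=> f g [? ?] [? ?]; split; apply: IHs.
Qed.

Lemma vals_inZ J s j c (f : cochain s j) : is_ideal J ->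
  vals_in J f -> vals_in J (c *: f).
Proof.
move=> JI; elim: s j f => [|a s IHs] [|[|j]] //=.
- by move=> f; apply: idealMl.
- by move=> f [? ?]; split; apply: IHs.
- by move=> f [? ?]; split; apply: IHs.
Qed.

Lemma vals_inN J s j (f : cochain s j) : is_ideal J ->
  vals_in J f -> vals_in J (- f).
Proof. by move=> ? ?; rewrite -scaleN1r; apply: vals_inZ. Qed.

Lemma vals_inB J s j (f g : cochain s j) : is_ideal J ->
  vals_in J f -> vals_in J g -> vals_in J (f - g).
Proof. by move=> ? ? ?; apply: vals_inD => //; apply: vals_inN. Qed.

Lemma vals_in_mono J J' s j c (f : cochain s j) : 
  (forall x, J x -> J' (c * x)) -> vals_in J f -> vals_in J' (c *: f).
Proof.
move=> sJJ'; elim: s j f => [|a s IHs] [|[|j]] //=.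
  by move=> f [? ?]; split; apply: IHs.
by move=> f [? ?]; split; apply: IHs.
Qed.

Lemma vals_in_sub J J' s j (f : cochain s j) :
  (forall x, J x -> J' x) -> vals_in J f -> vals_in J' f.
Proof.
move=> sJJ' Jf; rewrite -[f]scale1r.
by apply: vals_in_mono Jf => x; rewrite mul1r; apply: sJJ'.
Qed.

Lemma vals_inM J a s j (f : cochain s j) : is_ideal J -> J a ->
  vals_in J (a *: f).
Proof.
move=> JI Ja; apply: (@vals_in_mono (fun=> True)) => [x _|].
  by rewrite mulrC; apply: idealMl.
exact: vals_inT.
Qed.

Lemma vals_in_diff J s j (f : cochain s j) : is_ideal J ->
  vals_in J f -> vals_in J (diff f).
Proof.
move=> JI; elim: s j f => [|a s IHs] [|j] //=.
- by move=> *; apply: ideal0.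
- by move=> *; split; apply: vals_in0.
move=> f [f1 f2]; split; first exact: IHs.
by apply: vals_inB => //; [apply: vals_inZ | apply: IHs].
Qed.

Lemma vals_in_adjoin J a s j (f : cochain s j) :
  vals_in (adjoin J a) f -> exists g : cochain s j, vals_in J (f - a *: g).
Proof.
elim: s j f => [|b s IHs] [|j] //=.
  case: j => [|j] f; last by exists 0.
  by case=> x Jx [r ->]; exists r; rewrite /GRing.scale /= mulrC addrK.
by move=> f [/IHs [g1 ?] /IHs [g2 ?]]; exists (g1, g2).
Qed.

Lemma vals_in_reg J a s j (f : cochain s j) :
  (forall g, J (a * g) -> J g) -> vals_in J (a *: f) -> vals_in J f.
Proof.
move=> rega; elim: s j f => [|b s IHs] [|[|j]] //=.
  by move=> f [? ?]; split; apply: IHs.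
by move=> f [? ?]; split; apply: IHs.
Qed.

(** Interior multiplication by the basis vector dual to the first occurrence of
    [a] in [s]. *)
Fixpoint contract a s : forall j, cochain s j.+1 -> cochain s j :=
  match s return forall j, cochain s j.+1 -> cochain s j with
  | [::] => fun _ _ => 0
  | b :: s' => fun j =>
    match j return cochain (b :: s') j.+1 -> cochain (b :: s') j with
    | 0 => fun _ => 0
    | j'.+1 => fun f =>
      if a == b then (f.2, 0) else (contract a f.1, - contract a f.2)
    end
  end.

Lemma contract_lin a s j c (f g : cochain s j.+1) :
  contract a (c *: f + g) = c *: contract a f + contract a g.
Proof.
elim: s j f g => [|b s IHs] [|j] //= f g; rewrite ?scaler0 ?addr0 //.
case: eqP => _; congr (_, _); rewrite /= ?scaler0 ?addr0 ?IHs //.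
by rewrite opprD scalerN.
Qed.

Lemma contract0 a s j : contract a (0 : cochain s j.+1) = 0.
Proof.
have := contract_lin a 1 (0 : cochain s j.+1) 0.
by rewrite !scale1r addr0 => e; apply: (addrI (contract a 0)); rewrite addr0 -e.
Qed.

Lemma contractB a s j c (f g : cochain s j.+1) :
  contract a (c *: f - g) = c *: contract a f - contract a g.
Proof.
rewrite contract_lin; congr (_ + _).
by have := contract_lin a (-1) g 0; rewrite !addr0 contract0 addr0 !scaleN1r.
Qed.

Lemma vals_in_contract J a s j (f : cochain s j.+1) : is_ideal J ->
  vals_in J f -> vals_in J (contract a f).
Proof.
move=> JI; elim: s j f => [j f _|b s IHs [|j] //= f].
  exact: (vals_in0 [::] j JI).
move=> [f1 f2]; case: eqP => _; split=> //=.
- exact: vals_in0.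
- exact: IHs.
- by apply: vals_inN => //; apply: IHs.
Qed.

Lemma cochain0 s (f : cochain s 0) : f = 0.
Proof. by case: s f => [|a s] f; rewrite /= (thinmx0 f). Qed.

(** Cartan's formula: multiplication by an entry of [s] is null-homotopic. *)
Lemma homotopy a s j (f : cochain s j.+1) : a \in s ->
  diff (contract a f) + contract a (diff f) = a *: f.
Proof.
elim: s j f => [|b s IHs] //= j f; rewrite inE.
case: eqP => [<- _ | _ /= a_s].
  case: j f => [|j] [f1 f2] /=.
    rewrite (cochain0 f2) diff0 subr0 add0r; congr (_, _).
    by rewrite ?scaler0.
  by rewrite diff0 subr0; congr (_, _); rewrite /= ?addr0 // addrC subrK.
case: j f => [|j] [f1 f2] /=.
  rewrite add0r; congr (_, _).
    by rewrite -(IHs 0%N) // [contract a f1]cochain0 diff0 add0r.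
  by rewrite [RHS]cochain0 [LHS]cochain0.
congr (_, _); rewrite /= ?IHs //.
rewrite contractB diffN opprK -(IHs _ f2) // opprB.
have cancel3 (M : zmodType) (x y z : M) : x + y + (z - x) = y + z.
  by rewrite [x + y]addrC -addrA [x + _]addrC subrK.
exact: cancel3.
Qed.

Definition kills J s j (a : R) : Prop := forall f : cochain s j.+1,
  vals_in J (diff f) -> exists g : cochain s j, vals_in J (a *: f - diff g).

Definition acyclic J s j : Prop := forall f : cochain s j.+1,
  vals_in J (diff f) -> exists g : cochain s j, vals_in J (f - diff g).

Lemma kills_ideal J s j : is_ideal J -> is_ideal (kills J s j).
Proof.
move=> JI; split=> [f df|a b Ka Kb f df|r a Ka f df].
- by exists 0; rewrite scale0r diff0 subr0; apply: vals_in0.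
- have [g1 h1] := Ka f df; have [g2 h2] := Kb f df.
  exists (g1 + g2); rewrite scalerDl diffD opprD addrACA.
  exact: vals_inD.
- have [g h] := Ka f df; exists (r *: g).
  by rewrite -scalerA diffZ -scalerBr; apply: vals_inZ.
Qed.

Lemma kills_mem J s j a : is_ideal J -> a \in s -> kills J s j a.
Proof.
move=> JI a_s f df; exists (contract a f).
rewrite -(homotopy f a_s) addrAC [X in X + _]subrr add0r.
exact: vals_in_contract.
Qed.

Lemma kills_ideal_mem J s j a : is_ideal J -> J a -> kills J s j a.
Proof.
move=> JI Ja f _; exists 0; rewrite diff0 subr0.
exact: vals_inM.
Qed.

(** Multiplication by the first element [a] of the sequence is zero on the
    cohomology of [R/J], so the long exact sequence of
    [0 -> R/J -> R/J -> R/(J + (a)) -> 0] splits into short ones, and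
    the vanishing range grows by one for each element. *)
Lemma weakly_regular_acyclic J s r j : is_ideal J -> weakly_regular J r ->
  (forall a, a \in r -> adjoins J s a) -> (j < size r)%N -> acyclic J s j.
Proof.
elim: r J j => //= a r IHr J j JI [rega wr] r_s lt_j f df.
have JaI := adjoin_ideal a JI.
have [g hg] : exists g : cochain s j, vals_in J (a *: f - diff g).
  apply: (@adjoins_sub J _ s (kills_ideal s j JI)) df.
  - by move=> x Jx; apply: kills_ideal_mem.
  - by move=> x xs; apply: kills_mem.
  - by apply: r_s; rewrite mem_head.
have [g1 hg1] : exists g1, vals_in J (diff (g - a *: g1)).
  case: j lt_j f df g hg => [|j] lt_j f df g hg.
    by exists 0; rewrite [_ - _]cochain0 diff0; apply: vals_in0.
  have [|||g2 hg2] := IHr _ j JaI wr _ _ g.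
  - move=> b b_r; apply: adjoins_mono (r_s b _) => //.
      by move=> x; apply: sub_adjoin.
    by rewrite inE b_r orbT.
  - exact: lt_j.
  - rewrite -[diff g](subKr (a *: f)); apply: vals_inB => //.
      by apply: vals_inM => //; apply: mem_adjoin.
    by apply: vals_in_sub hg => x; apply: sub_adjoin.
  have [g1 hg1] := vals_in_adjoin hg2.
  exists g1; rewrite -[g](subrK (diff g2)) addrAC diffD diff_diff addr0.
  exact: vals_in_diff.
exists g1; apply: (vals_in_reg rega).
have := vals_inD JI hg hg1.
by rewrite diffB diffZ addrA subrK scalerBr.
Qed.

Fixpoint cmap (t : R -> R) s : forall j, cochain s j -> cochain s j :=
  match s return forall j, cochain s j -> cochain s j with
  | [::] => fun j =>
    match j return cochain [::] j -> cochain [::] j with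
    | 1 => fun f => t f
    | _ => fun _ => 0
    end
  | a :: s' => fun j =>
    match j return cochain (a :: s') j -> cochain (a :: s') j with
    | 0 => fun _ => 0
    | j'.+1 => fun f => (cmap t f.1, cmap t f.2)
    end
  end.

Lemma cmapB (t : {additive R -> R}) s j (f g : cochain s j) :
  cmap t (f - g) = cmap t f - cmap t g.
Proof.
by elim: s j f g => [|a s IHs] [|[|j]] //= f g;
  rewrite ?subr0 ?raddfB // !IHs.
Qed.

Lemma cmap0 (t : {additive R -> R}) s j : cmap t (0 : cochain s j) = 0.
Proof. by rewrite -[X in cmap t X](subrr 0) cmapB [LHS]subrr. Qed.

Lemma cmapN (t : {additive R -> R}) s j (f : cochain s j) :
  cmap t (- f) = - cmap t f.
Proof. by rewrite -sub0r cmapB cmap0 sub0r. Qed.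

Lemma vals_in_cmap J J' (t : R -> R) s j (f : cochain s j) :
  (forall x, J x -> J' (t x)) -> vals_in J f -> vals_in J' (cmap t f).
Proof.
move=> Jt; elim: s j f => [|a s IHs] [|[|j]] //=.
  by move=> f [? ?]; split; apply: IHs.
by move=> f [? ?]; split; apply: IHs.
Qed.

Lemma cmap_scale (t t' : R -> R) a s j (f : cochain s j) :
  (forall x, t' (a * x) = a * t x) -> cmap t' (a *: f) = a *: cmap t f.
Proof.
move=> tt'; elim: s j f => [|b s IHs] [|[|j]] //= f; rewrite ?scaler0 //.
all: by congr (_, _); rewrite /= IHs.
Qed.

Lemma cmap_diff (t t' : {additive R -> R}) s j (f : cochain s j) :
  (forall a x, a \in s -> t' (a * x) = a * t x) ->
  cmap t' (diff f) = diff (cmap t f).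
Proof.
elim: s j f => [|a s IHs] [|j] //= f tt'; first by rewrite raddf0.
  by rewrite !cmap0.
have tt's b x : b \in s -> t' (b * x) = b * t x.
  by move=> bs; apply: tt'; rewrite inE bs orbT.
rewrite cmapB IHs // IHs // (@cmap_scale t) // => x.
by apply: tt'; rewrite mem_head.
Qed.

Lemma cmap_id (t : nat -> R -> R) s j (f : cochain s j) :
  (forall x, exists D0, forall D, (D0 <= D)%N -> t D x = x) ->
  exists D0, forall D, (D0 <= D)%N -> cmap (t D) f = f.
Proof.
move=> t_id; elim: s j f => [|a s IHs] [|j] f.
- by exists 0%N => D _; rewrite [RHS]cochain0.
- case: j f => [|j] f /=; first exact: t_id.
  by exists 0%N => D _; rewrite [RHS]thinmx0.
- by exists 0%N => D _; rewrite [RHS]cochain0.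
case: f => f1 f2; have [D1 h1] := IHs _ f1; have [D2 h2] := IHs _ f2.
exists (maxn D1 D2) => D; rewrite geq_max => /andP[le1 le2] /=.
by rewrite h1 ?h2.
Qed.

(** Graded Nakayama lemma. The cone on multiplication by [a] shows that [a] is
    surjective on the cohomology for [s]. The operators [t D] stand for the
    truncation to degrees less than [D]: iterating, each cocycle agrees with a
    coboundary up to terms of arbitrarily large degree ([approx]), and
    truncating this identity above the degree of the cocycle makes it exact. *)
Lemma acyclic_behead J (t : nat -> {additive R -> R}) a s j :
    is_ideal J -> (forall D x, J x -> J (t D x)) ->
    (forall D b x, b \in a :: s -> t D.+1 (b * x) = b * t D x) ->
    (forall x, t 0 x = 0) ->
    (forall x, exists D0, forall D, (D0 <= D)%N -> t D x = x) ->
  acyclic J (a :: s) j.+1 -> acyclic J s j.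
Proof.
move=> JI Jt t_shift t0 t_id ac.
have ac_s (f : cochain s j.+1) : vals_in J (diff f) -> exists g h,
    vals_in J (diff g) /\ vals_in J (f - a *: g - diff h).
  move=> df; have [|[g h] /= [hg hh]] := ac (0, f).
    split => /=; first by rewrite diff0; apply: vals_in0.
    by rewrite scaler0 sub0r; apply: vals_inN.
  exists g, (- h); rewrite diffN opprK; split.
    by rewrite -[diff g]opprK; apply: vals_inN => //; rewrite -sub0r.
  by move: hh; rewrite opprB addrA addrAC.
have approx D (f : cochain s j.+1) : vals_in J (diff f) ->
    exists h, vals_in J (cmap (t D) (f - diff h)).
  elim: D f => [|D IHD] f df.
    exists 0; move: (f - _) => f'.
    apply: (@vals_in_cmap (fun=> True)) => [x _|]; last exact: vals_inT.
    by rewrite t0; apply: ideal0.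
  have [g [h [dg hf]]] := ac_s f df; have [h' hg] := IHD g dg.
  exists (h + a *: h').
  have -> : f - diff (h + a *: h') = f - a *: g - diff h + a *: (g - diff h').
    rewrite diffD diffZ scalerBr opprD !addrA; congr (_ - _).
    by rewrite [RHS]addrAC subrK.
  rewrite -[X in cmap _ (_ + X)]opprK cmapB cmapN opprK.
  apply: vals_inD => //; first by apply: vals_in_cmap hf => x; apply: Jt.
  rewrite (@cmap_scale (t D)) => [|x]; last by rewrite t_shift ?mem_head.
  exact: vals_inZ.
move=> f df; have [D0 f_id] := cmap_id f t_id.
have [h hf] := approx D0.+1 f df; exists (cmap (t D0) h).
rewrite -(@cmap_diff (t D0) (t D0.+1)).
  by rewrite -[X in X - _](f_id D0.+1) // -cmapB.
by move=> b x bs; apply: t_shift; rewrite inE bs orbT.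
Qed.

Lemma acyclic_drop J (t : nat -> {additive R -> R}) s1 s2 j :
    is_ideal J -> (forall D x, J x -> J (t D x)) ->
    (forall D b x, b \in s1 ++ s2 -> t D.+1 (b * x) = b * t D x) ->
    (forall x, t 0 x = 0) ->
    (forall x, exists D0, forall D, (D0 <= D)%N -> t D x = x) ->
  acyclic J (s1 ++ s2) (size s1 + j) -> acyclic J s2 j.
Proof.
move=> JI Jt + t0 t_id; elim: s1 => //= a s IHs t_shift.
move=> /(acyclic_behead JI Jt t_shift t0 t_id); apply: IHs => D b x bs.
by apply: t_shift; rewrite inE bs orbT.
Qed.

Fixpoint cochain_deg0 s (u : R) : cochain s 1 :=
  if s is a :: s' then (cochain_deg0 s' u, 0) else u.

Lemma cochain_deg0P s (f : cochain s 1) : exists u, f = cochain_deg0 s u.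
Proof.
elim: s f => [|a s IHs] f /=; first by exists f.
case: f => f1 f2; have [u ->] := IHs f1.
by exists u; rewrite (cochain0 f2).
Qed.

Lemma vals_in_deg0 J s u : is_ideal J -> vals_in J (cochain_deg0 s u) <-> J u.
Proof.
move=> JI; elim: s => //= a s IHs; split=> [[/IHs]|Ju] //.
by split; [apply/IHs | apply: vals_in0].
Qed.

Lemma cochain_deg0_lin s c u v :
  cochain_deg0 s (c * u - v) = c *: cochain_deg0 s u - cochain_deg0 s v.
Proof.
by elim: s => //= a s ->; congr (_, _); rewrite /= scaler0 subr0.
Qed.

Section Degree1.

Variables (T : eqType) (x : T -> R).

Fixpoint cochain_deg1 (l : seq T) (phi : T -> R) : cochain (map x l) 2 :=
  match l return cochain (map x l) 2 with
  | [::] => 0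
  | v :: l' => (cochain_deg1 l' phi, cochain_deg0 (map x l') (phi v))
  end.

Lemma vals_in_deg1 J l phi : is_ideal J ->
  vals_in J (cochain_deg1 l phi) <-> {in l, forall v, J (phi v)}.
Proof.
move=> JI; elim: l => //= v l IHl.
split=> [[/IHl Jl /(vals_in_deg0 _ _ JI) Jv] w|Jl].
  by rewrite inE => /orP[/eqP->|/Jl].
split; first by apply/IHl => w wl; apply: Jl; rewrite inE wl orbT.
by apply/vals_in_deg0 => //; apply: Jl; rewrite mem_head.
Qed.

Lemma cochain_deg1_lin l c phi psi :
  cochain_deg1 l (fun w => c * phi w - psi w) =
  c *: cochain_deg1 l phi - cochain_deg1 l psi.
Proof.
elim: l => [|v l IHl] /=; first by rewrite scaler0 subr0.
by rewrite IHl cochain_deg0_lin.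
Qed.

Lemma diff_deg0 l u :
  diff (cochain_deg0 (map x l) u) = cochain_deg1 l (fun v => x v * u).
Proof.
have deg0_0 s : cochain_deg0 s 0 = 0 by elim: s => //= a s ->.
elim: l => //= v l ->; congr (_, _); rewrite /= diff0 subr0.
by have := cochain_deg0_lin (map x l) (x v) u 0; rewrite deg0_0 !subr0 => ->.
Qed.

Lemma vals_in_diff_deg1 J l phi : is_ideal J ->
  {in l &, forall v w, J (x v * phi w - x w * phi v)} ->
  vals_in J (diff (cochain_deg1 l phi)).
Proof.
move=> JI; elim: l => [|v l IHl] //= compat; split.
  by apply: IHl => w w' wl w'l; apply: compat; rewrite inE ?wl ?w'l orbT.
rewrite diff_deg0 -cochain_deg1_lin; apply/vals_in_deg1 => // w wl.
by apply: compat; rewrite inE ?eqxx ?wl ?orbT.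
Qed.

(** Degree [0] cohomology is the annihilator of the elements [x v]. *)
Lemma acyclic_deg0 J l u : is_ideal J -> acyclic J (map x l) 0 ->
  {in l, forall v, J (x v * u)} -> J u.
Proof.
move=> JI ac Ju; have [|g] := ac (cochain_deg0 _ u).
  by rewrite diff_deg0; apply/vals_in_deg1.
by rewrite (cochain0 g) diff0 subr0 vals_in_deg0.
Qed.

(** Degree [1] cocycles are the families [phi] compatible with a fraction
    [phi v / x v] independent of [v]; exactness says that this fraction is an
    element of the ring modulo [J]. *)
Lemma acyclic_deg1 J l phi : is_ideal J -> acyclic J (map x l) 1 ->
  {in l &, forall v w, J (x v * phi w - x w * phi v)} ->
  exists z, {in l, forall v, J (phi v - x v * z)}.
Proof.
move=> JI ac compat.
have [|g] := ac (cochain_deg1 l phi); first exact: vals_in_diff_deg1.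
have [z ->] := cochain_deg0P g; rewrite diff_deg0 => hz; exists z.
apply/(vals_in_deg1 _ _ JI).
have -> : (fun v => phi v - x v * z) = (fun v => 1 * phi v - x v * z).
  by apply/funext => v; rewrite mul1r.
by rewrite cochain_deg1_lin scale1r.
Qed.

End Degree1.

End Ideals.

(** * Algebraic independence along regular chains of ideals *)
Section Growth.

Variables (k : fieldType) (n : nat).
Local Notation R := {mpoly k[n]}.
Implicit Types (J : set R) (T : finType).

Definition free_mod J T (g : T -> R) : Prop :=
  forall c : T -> k, J (\sum_t c t *: g t) -> forall t, c t = 0.

(** The terms of lowest order in [f] of an element of [J] lie in [J'], since the
    power of [f] in front can be cancelled modulo [J]. *)
Lemma power_sum_regular J J' f N (h : 'I_N -> R) :
    is_ideal J -> is_ideal J' -> (forall x, J x -> J' x) -> J' f ->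
    (forall x, J (f * x) -> J x) -> (forall i, J' (h i) -> h i = 0) ->
  J (\sum_(i < N) f ^+ i * h i) -> forall i, J' (h i).
Proof.
move=> JI J'I sJJ' J'f regf; elim: N h => [|N IHN] h h0; first by move=> _ [].
rewrite big_ord_recl expr0 mul1r.
under eq_bigr do rewrite exprS -mulrA.
rewrite -mulr_sumr => Jsum.
have J'h0 : J' (h ord0).
  rewrite -(addrK (f * \sum_(i < N) f ^+ i * h (lift ord0 i)) (h ord0)).
  apply: idealB => //; first exact: sJJ'.
  by rewrite mulrC; apply: idealMl.
move: Jsum; rewrite h0 // add0r => /regf Jsum i.
have [j ->|->] := unliftP ord0 i.
  exact: IHN (fun i => h (lift ord0 i)) (fun i => h0 _) Jsum j.
exact: J'h0.
Qed.

Lemma free_mod_powers J J' f N T (g : T -> R) :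
    is_ideal J -> is_ideal J' -> (forall x, J x -> J' x) -> J' f ->
    (forall x, J (f * x) -> J x) -> free_mod J' g ->
  free_mod J (fun p : 'I_N * T => f ^+ p.1 * g p.2).
Proof.
move=> JI J'I sJJ' J'f regf free_g c Jc.
have c0 i : J' (\sum_t c (i, t) *: g t) -> forall t, c (i, t) = 0.
  exact: free_g.
suff J'h i : J' (\sum_t c (i, t) *: g t) by case=> i t; apply: c0.
apply: (power_sum_regular JI J'I sJJ' J'f regf
  (h := fun i => \sum_t c (i, t) *: g t)) => {i} [i /c0 ci0|].
  by rewrite big1 // => t _; rewrite ci0 scale0r.
suff -> : \sum_(i < N) f ^+ i * \sum_t c (i, t) *: g t =
    \sum_(p : 'I_N * T) c p *: (f ^+ p.1 * g p.2) by [].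
rewrite (eq_bigr (fun i : 'I_N => \sum_t c (i, t) *: (f ^+ i * g t))).
  by rewrite pair_bigA; apply: eq_bigr => -[].
move=> i _; rewrite mulr_sumr.
by apply: eq_bigr => t _; rewrite scalerAr.
Qed.

Definition deg_le D (p : R) : bool := (msize p <= D.+1)%N.

Lemma deg_leM D E p q : deg_le D p -> deg_le E q -> deg_le (D + E) (p * q).
Proof.
rewrite /deg_le => pD qE.
have [->|p0] := eqVneq p 0; first by rewrite mul0r msize0.
have [->|q0] := eqVneq q 0; first by rewrite mulr0 msize0.
rewrite msizeM //; move: (msize p) (msize q) pD qE => a b; lia.
Qed.

Lemma deg_le1 : deg_le 0 1. Proof. by rewrite /deg_le msize1. Qed.

Lemma deg_leX D p i : deg_le D p -> deg_le (D * i) (p ^+ i).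
Proof.
move=> pD; elim: i => [|i IHi]; first by rewrite muln0 deg_le1.
by rewrite exprS mulnS; apply: deg_leM.
Qed.

Lemma deg_leW D E p : (D <= E)%N -> deg_le D p -> deg_le E p.
Proof. by rewrite /deg_le => *; lia. Qed.

(** The common shape of a strict chain of prime ideals and of the ideals
    generated by the initial segments of a regular sequence. *)
Definition regular_chain (d : nat) (J : nat -> set R) (f : nat -> R) : Prop :=
  [/\ forall i, (i <= d)%N -> is_ideal (J i),
      forall i, (i < d)%N -> forall x, J i x -> J i.+1 x,
      forall i, (i < d)%N -> J i.+1 (f i),
      forall i, (i < d)%N -> forall x, J i (f i * x) -> J i x &
      ~ J d 1].

Lemma regular_chain_prefix d d' (J : nat -> set R) (f : nat -> R) :
  (d' <= d)%N -> regular_chain d J f -> regular_chain d' J f.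
Proof.
move=> le_d [J_id J_sub J_f f_reg J1]; split=> [i|i|i|i|] le_i.
- exact: J_id (leq_trans le_i le_d).
- exact: J_sub (leq_trans le_i le_d).
- exact: J_f (leq_trans le_i le_d).
- exact: f_reg (leq_trans le_i le_d).
apply: J1; move: le_i; elim: d {J_id J_f f_reg} le_d J_sub => [|d IHd].
  by rewrite leqn0 => /eqP->.
rewrite leq_eqVlt => /orP[/eqP->//|le_d] J_sub J1.
apply: (J_sub) => //; apply: IHd => // i lt_i.
by apply: J_sub; apply: ltnW.
Qed.

(** The family [g] consists of the monomials in the [f i] with exponents less
    than [N]. *)
Lemma regular_chain_free d (J : nat -> set R) (f : nat -> R) N D :
    regular_chain d J f -> (forall i, (i < d)%N -> deg_le D (f i)) ->
  exists T (g : T -> R), [/\ #|T| = (N ^ d)%N, free_mod (J 0%N) g &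
    forall t, deg_le (D * N * d) (g t)].
Proof.
elim: d J f => [|d IHd] J f [J_id J_sub J_f f_reg J1] f_deg.
  exists unit, (fun=> 1); split=> [|c|_]; first by rewrite card_unit.
    rewrite (bigD1 tt) //= big1 ?addr0 => [|[]] // Jc [].
    apply/eqP; apply: contra_notT J1 => c_neq0.
    rewrite -[1](scale1r) -(mulVf c_neq0) -scalerA -mul_mpolyC.
    by apply: idealMl => //; apply: J_id.
  by rewrite muln0 deg_le1.
have [||T [g [card_T free_g g_deg]]] := IHd (fun i => J i.+1) (fun i => f i.+1).
- by split=> // i lt_i; [apply: J_id|apply: J_sub|apply: J_f|apply: f_reg].
- by move=> i lt_i; apply: f_deg.
exists ('I_N * T)%type, (fun p : 'I_N * T => f 0%N ^+ p.1 * g p.2); split.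
- by rewrite card_prod card_ord card_T expnS.
- apply: (@free_mod_powers _ (J 1%N)) => //; try exact: J_id.
  + exact: J_sub.
  + exact: J_f.
  + exact: f_reg.
case=> i t; rewrite mulnS; apply: deg_leM => //=.
apply: (@deg_leW (D * i)); first by rewrite leq_mul2l ltnW ?orbT.
by apply: deg_leX; apply: f_deg.
Qed.

(** Modulo an ideal containing all [bad] monomials, the family lives in a space
    spanned by the values of [mon]. *)
Lemma free_mod_card J (bad : pred 'X_{1..n}) E T (g : T -> R)
    (L : finType) (mon : L -> 'X_{1..n}) :
    (forall p, {in msupp p, forall m, bad m} -> J p) ->
    (forall m, (mdeg m <= E)%N -> ~~ bad m -> exists l, mon l = m) ->
    free_mod J g -> (forall t, deg_le E (g t)) ->
  (#|T| <= #|L|)%N.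
Proof.
move=> badJ mon_onto free_g g_deg.
pose M := \matrix_(i < #|T|, j < #|L|) (g (enum_val i))@_(mon (enum_val j)).
have [//|lt_card] := leqP.
have /rowV0Pn[v /sub_kermxP vM v_neq0] : kermx M != 0.
  rewrite kermx_eq0 /row_free neq_ltn; apply/orP; left.
  exact: leq_ltn_trans (rank_leq_col M) lt_card.
case/eqP: v_neq0; apply/rowP => i; rewrite mxE.
rewrite -(enum_valK i); apply: (free_g (fun t => v 0 (enum_rank t))).
apply: badJ => m; rewrite mcoeff_msupp.
apply: contraR => bad'm; apply/eqP.
have [le_m|lt_m] := leqP (mdeg m) E; last first.
  rewrite raddf_sum big1 //= => t _; rewrite mcoeffZ memN_msupp_eq0 ?mulr0 //.
  by apply: msize_mdeg_ge; apply: leq_trans (g_deg t) lt_m.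
have [l <-] := mon_onto m le_m bad'm.
move/rowP: vM => /(_ (enum_rank l)); rewrite !mxE => <-.
rewrite raddf_sum (reindex_onto (@enum_val T predT) enum_rank) /=; last first.
  by move=> t _; exact: enum_rankK.
apply: eq_big => [j|j _]; first by rewrite enum_valK eqxx.
by rewrite mxE !enum_valK mcoeffZ enum_rankK.
Qed.

End Growth.

(** * Edge ideals with added variables as monomial ideals *)
Section FaceIdeals.

Variables (k : fieldType) (V : finType) (e : rel V).
Hypotheses (e_sym : symmetric e) (e_irr : irreflexive e).
Local Notation n := #|V|.
Local Notation R := {mpoly k[n]}.
Implicit Types (K S : {set V}) (m : 'X_{1..n}) (p : R).

Definition independent S : bool := [forall v in S, forall w in S, ~~ e v w].

Lemma independentP S :
  reflect {in S &, forall v w, ~~ e v w} (independent S).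
Proof.
apply: (iffP 'forall_in_forall_inP) => indS v; last by move=> vS w; apply: indS.
by move=> w vS; apply: indS.
Qed.

Definition nbhd (v : V) : {set V} := [set w | e v w].

Definition vsupp m : {set V} := [set v | m (enum_rank v) != 0%N].

Lemma vsuppD m m' : vsupp (m + m')%MM = vsupp m :|: vsupp m'.
Proof. by apply/setP => v; rewrite !inE mnmDE addn_eq0 negb_and. Qed.

Lemma vsuppU v : vsupp U_(enum_rank v)%MM = [set v].
Proof.
apply/setP => w; rewrite !inE mnm1E (inj_eq enum_rank_inj) [v == w]eq_sym.
by case: (w == v).
Qed.

Lemma vsuppE v m : (v \in vsupp m) = (U_(enum_rank v) <= m)%MM.
Proof. by rewrite inE lep1mP. Qed.

(** The monomials in the ideal generated by the edges and by the variables of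
    [K]: the others are supported on independent sets avoiding [K]. *)
Definition nonface K m : bool :=
  ~~ (independent (vsupp m) && [disjoint vsupp m & K]).

Definition face_ideal K : set R :=
  [set p | {in msupp p, forall m, nonface K m}].

Lemma independent_sub S S' : S \subset S' -> independent S' -> independent S.
Proof.
move=> /subsetP sub /independentP ind; apply/independentP => v w vS wS.
by apply: ind; apply: sub.
Qed.

Lemma nonfaceD K m m' : nonface K m -> nonface K (m + m')%MM.
Proof.
apply: contra; rewrite vsuppD => /andP[ind dis]; apply/andP; split.
  by apply: independent_sub ind; apply: subsetUl.
by apply: disjointWl dis; apply: subsetUl.
Qed.

Lemma face_idealP K p : face_ideal K p <-> forall m, ~~ nonface K m -> p@_m = 0.
Proof.
split=> [Ip m|Ip m].
  by apply: contraNeq; rewrite -mcoeff_msupp; apply: Ip.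
by rewrite mcoeff_msupp; apply: contra_neqT; apply: Ip.
Qed.

Lemma face_ideal_ideal K : is_ideal (face_ideal K).
Proof.
split=> [m|p q Ip Iq m|r p Ip m].
- by rewrite msupp0.
- by move=> /msuppD_le; rewrite mem_cat => /orP[/Ip|/Iq].
move=> /msuppM_le /allpairsP[[m1 m2] /= [_ /Ip m2_bad ->]].
by rewrite addmC; apply: nonfaceD.
Qed.

Lemma face_idealX K m : face_ideal K 'X_[m] <-> nonface K m.
Proof.
split=> [|bad m']; first by apply; rewrite msuppX mem_head.
by rewrite msuppX inE => /eqP->.
Qed.

Definition var (v : V) : R := 'X_(enum_rank v).
Local Notation x := var.

Lemma mul_var v p m : (x v * p)@_(U_(enum_rank v) + m) = p@_m.
Proof. by rewrite mulrC mcoeffMX. Qed.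

Lemma face_ideal_var K v : v \in K -> face_ideal K (x v).
Proof.
move=> vK; apply/face_idealX; rewrite /nonface vsuppU negb_and orbC.
by rewrite disjoints1 vK.
Qed.

Lemma face_ideal_mono K K' p : K \subset K' -> face_ideal K p -> face_ideal K' p.
Proof.
move=> sub Ip m /Ip; apply: contra => /andP[-> dis] /=.
exact: disjointWr dis.
Qed.

Lemma adjoin_face_ideal K v : adjoin (face_ideal K) (x v) = face_ideal (v |: K).
Proof.
have vKI := face_ideal_ideal (v |: K).
apply/seteqP; split=> [_ [j Ij [r ->]]|p Ip].
  apply: (idealD vKI); first by apply: face_ideal_mono Ij; apply: subsetUr.
  by apply: (idealMl _ vKI); apply: face_ideal_var; rewrite setU11.
have adjI := adjoin_ideal (x v) (face_ideal_ideal K).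
rewrite [p]mpolyE big_seq; apply: big_ind => [|a b|m /Ip m_bad].
- exact: ideal0 adjI.
- exact: idealD adjI.
rewrite -mul_mpolyC; apply: (idealMl _ adjI).
have [v_m|v_m] := boolP (v \in vsupp m).
  exists 0; first exact: ideal0 (face_ideal_ideal _).
  exists 'X_[m - U_(enum_rank v)]; rewrite add0r -mpolyXD submK //.
  by rewrite -vsuppE.
apply: sub_adjoin; apply/face_idealX.
move: m_bad; apply: contra => /andP[-> dis] /=.
by rewrite -setI_eq0 setIUr setU_eq0 !setI_eq0 disjoint_sym disjoints1 v_m.
Qed.

Lemma independentU1 v S :
  independent (v |: S) = independent S && [disjoint S & nbhd v].
Proof.
have evv : ~~ e v v by rewrite e_irr.
apply/idP/andP => [indvS|[/independentP indS dis]].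
  split; first by apply: independent_sub indvS; apply: subsetUr.
  apply/pred0P => w /=; apply/negP; rewrite inE => /andP[wS evw].
  move/independentP: indvS => /(_ v w).
  by rewrite setU11 setU1r // evw => /(_ _ _)/negP; apply.
have dis' w : w \in S -> ~~ e v w.
  by move=> wS; have := disjointFr dis wS; rewrite inE => ->.
apply/independentP => w w'; rewrite !in_setU1.
move=> /orP[/eqP->|wS] /orP[/eqP->|w'S] //.
- exact: dis'.
- by rewrite e_sym dis'.
- exact: indS.
Qed.

(** A monomial becomes a nonface after multiplication by [x v] if and only if
    its support was not independent, or meets [K], or contains a neighbor of
    [v]. *)
Lemma colon_face_ideal K v : v \notin K ->
  colon (face_ideal K) (x v) = face_ideal (K :|: nbhd v).
Proof.
move=> vK.
have face m : nonface K (U_(enum_rank v) + m)%MM = nonface (K :|: nbhd v) m.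
  rewrite /nonface vsuppD vsuppU independentU1 -!setI_eq0 setIUl setIUr.
  rewrite !setU_eq0 [[set v] :&: K == set0]setI_eq0 disjoints1 vK /=.
  by rewrite -!andbA [(_ :&: nbhd v == _) && _]andbC.
apply/seteqP; split=> p; rewrite /colon /=.
  move=> Ip; apply/face_idealP => m m_face; rewrite -(mul_var v).
  by move/face_idealP: Ip; apply; rewrite face.
move=> Ip m; rewrite mulrC => /msuppM_le /allpairsP[[m1 m2] /= [m1_p]].
by rewrite msuppX inE => /eqP-> ->; rewrite addmC face; apply: Ip.
Qed.

Lemma face_ideal_edges : face_ideal set0 = ideal_gen (@edge_monomials k V e).
Proof.
apply/seteqP; split=> [p Ip|_ [s s_edge ->]]; last first.
  rewrite big_seq; apply: big_ind.
  - exact: ideal0 (face_ideal_ideal _).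
  - by move=> a b; apply: idealD (face_ideal_ideal _).
  move=> [a b] /s_edge /= [v [w [evw ->]]].
  apply: (idealMl _ (face_ideal_ideal _)).
  rewrite -mpolyXD; apply/face_idealX.
  rewrite /nonface negb_and; apply/orP; left; apply/negP => /independentP /(_ v w).
  by rewrite vsuppD !vsuppU !inE !eqxx orbT evw => /(_ isT isT).
have genI := ideal_gen_ideal (@edge_monomials k V e).
rewrite [p]mpolyE big_seq; apply: big_ind => [|a b|m /Ip m_bad].
- exact: ideal0 genI.
- exact: idealD genI.
rewrite -mul_mpolyC; apply: (idealMl _ genI); move: m_bad.
rewrite /nonface -setI_eq0 setI0 eqxx andbT.
case/forall_inPn => v v_m /forall_inPn[w w_m]; rewrite negbK => evw.
have le_m : (U_(enum_rank v) + U_(enum_rank w) <= m)%MM.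
  apply/mnm_lepP => i; rewrite mnmDE !mnm1E; move: v_m w_m evw; rewrite !inE.
  move=> v_m w_m evw; have [<-|_] := eqVneq (enum_rank v) i.
    rewrite (inj_eq enum_rank_inj) (_ : w == v = false) ?addn0 ?lt0n //.
    by apply: contraTF evw => /eqP->; rewrite e_irr.
  by have [<-|] := eqVneq (enum_rank w) i; rewrite // lt0n.
rewrite -(submK le_m) mpolyXD; apply: (idealMl _ genI).
exists [:: (1, 'X_[U_(enum_rank v) + U_(enum_rank w)])] => [q|]; last first.
  by rewrite big_seq1 mul1r.
rewrite inE => /eqP-> /=; exists v, w; split=> //.
by rewrite mpolyXD.
Qed.

End FaceIdeals.

(** * Truncation of polynomials *)
Section Truncation.

Variables (k : fieldType) (n : nat).
Local Notation R := {mpoly k[n]}.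
Implicit Types (p : R) (m : 'X_{1..n}).

Definition trunc D p : R := \sum_(m : 'X_{1..n < D}) p@_m *: 'X_[m].

Lemma mcoeff_trunc D p m : (trunc D p)@_m = if (mdeg m < D)%N then p@_m else 0.
Proof.
have [lt_m|le_D] := ltnP; first exact: (mcoeff_mpoly (fun m => p@_m)).
rewrite raddf_sum big1 //= => m' _; rewrite mcoeffZ mcoeffX.
case: eqP => [e_m|_]; last by rewrite mulr0.
by move: le_D (bmdeg m'); rewrite -e_m => /leq_ltn_trans h /h; rewrite ltnn.
Qed.

Lemma trunc_is_zmod_morphism D : zmod_morphism (trunc D).
Proof.
move=> p q; apply/mpolyP => m; rewrite mcoeffB !mcoeff_trunc mcoeffB.
by case: ifP; rewrite ?subrr.
Qed.

HB.instance Definition _ D :=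
  GRing.isZmodMorphism.Build R R (trunc D) (trunc_is_zmod_morphism D).

Lemma truncXU D i p : trunc D.+1 ('X_i * p) = 'X_i * trunc D p.
Proof.
apply/mpolyP => m; rewrite mcoeff_trunc mulrC [in RHS]mulrC.
have [le_m|nle_m] := boolP (U_(i) <= m)%MM.
  rewrite -(submK le_m) addmC !mcoeffMX mcoeff_trunc mdegD mdeg1 add1n.
  by rewrite ltnS.
suff out (q : R) : (q * 'X_i)@_m = 0 by rewrite !out if_same.
apply: contraNeq nle_m; rewrite -mcoeff_msupp.
move=> /msuppM_le /allpairsP[[m1 m2] /= [_]].
by rewrite msuppX inE => /eqP-> ->; apply: lem_addl.
Qed.

Lemma trunc0 p : trunc 0 p = 0.
Proof. by apply/mpolyP => m; rewrite mcoeff_trunc mcoeff0. Qed.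

Lemma trunc_id p : exists D0, forall D, (D0 <= D)%N -> trunc D p = p.
Proof.
exists (msize p) => D le_D; apply/mpolyP => m; rewrite mcoeff_trunc.
case: ltnP => // le_m; rewrite memN_msupp_eq0 //.
by apply: msize_mdeg_ge; apply: leq_trans le_m.
Qed.

End Truncation.

(** * Bounds on dimension and depth of edge rings *)
Section FaceIdealBounds.

Variables (k : fieldType) (V : finType) (e : rel V).
Hypotheses (e_sym : symmetric e) (e_irr : irreflexive e).
Local Notation n := #|V|.
Local Notation R := {mpoly k[n]}.
Local Notation x := (@var k V).
Local Notation I := (@face_ideal k V e set0).
Implicit Types (K S C : {set V}) (m : 'X_{1..n}) (p : R).

Lemma nonface0 m : nonface e set0 m = ~~ independent e (vsupp m).
Proof. by rewrite /nonface -setI_eq0 setI0 eqxx andbT. Qed.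

(** A monomial is encoded by its support and the list of its exponents there,
    so that those with support of size at most [a] and exponents less than [E]
    are covered by [2 ^ n * E ^ a] codes. *)
Let tuple_monomial E a (l : {set V} * a.-tuple 'I_E) : 'X_{1..n} :=
  [multinom if enum_val i \in l.1
            then nth 0%N (map val l.2) (index (enum_val i) (enum l.1))
            else 0%N | i < n].

Lemma tuple_monomial_onto E a m : (#|vsupp m| <= a)%N -> (mdeg m <= E)%N ->
  exists l, @tuple_monomial E.+1 a l = m.
Proof.
move=> le_a le_E.
pose vals := [seq m (enum_rank v) | v <- enum (vsupp m)].
pose l := [tuple inord (nth 0%N vals i) | i < a] : a.-tuple 'I_E.+1.
exists (vsupp m, l).
apply/mnmP => i; rewrite mnmE /=; have [i_m|] := ifPn; last first.
  by rewrite inE negbK enum_valK => /eqP->.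
have lt_i : (index (enum_val i) (enum (vsupp m)) < #|vsupp m|)%N.
  by rewrite cardE index_mem mem_enum.
have lt_ia := leq_trans lt_i le_a.
rewrite (nth_map ord0) ?size_tuple ?card_ord //.
rewrite -[index _ _]/(val (Ordinal lt_ia)) -(tnth_nth ord0 l (Ordinal lt_ia)).
rewrite /l tnth_mktuple /=.
rewrite (nth_map (enum_val i)) -?cardE // nth_index ?mem_enum // enum_valK.
rewrite inordK // ltnS; apply: leq_trans le_E.
by rewrite mdegE (bigD1 i) //= leq_addr.
Qed.

(** A chain of length [a + 1] would give [N ^ (a + 1)] independent elements of
    degree at most a multiple of [N], in a space whose dimension is at most
    a constant times [N ^ a]. *)
Lemma regular_chain_le a d (J : nat -> set R) f :
    (forall S, independent e S -> #|S| <= a)%N ->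
    (forall p, I p -> J 0%N p) ->
  regular_chain d J f -> (d <= a)%N.
Proof.
move=> indep_le IJ chain; have [//|lt_a] := leqP d a.
have {lt_a} {}chain := regular_chain_prefix lt_a chain.
have [D f_deg] : exists D, forall i, (i < a.+1)%N -> deg_le D (f i).
  exists (\max_(i < a.+1) msize (f i)) => i lt_i.
  by apply: leqW; apply: (leq_bigmax (Ordinal lt_i)).
pose c := (a.+1 * D + 1)%N; pose N := (2 ^ n * c ^ a).+1.
have [T [g [card_T free_g g_deg]]] := regular_chain_free N chain f_deg.
have : (#|T| <= #|{: {set V} * a.-tuple 'I_(D * N * a.+1).+1}|)%N.
  apply: (free_mod_card (bad := nonface e set0)) free_g g_deg => [p Ip|m le_m].
    exact: IJ Ip.
  rewrite nonface0 negbK => ind.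
  by apply: tuple_monomial_onto => //; apply: indep_le.
rewrite card_T card_prod -cardsT -powersetT card_powerset cardsT.
rewrite card_tuple card_ord.
rewrite leqNgt => /negP[]; rewrite expnS.
apply: (@leq_ltn_trans (2 ^ n * (N * c) ^ a)).
  have le_Nc : ((D * N * a.+1).+1 <= N * c)%N by rewrite /c; nia.
  rewrite leq_mul2l; apply/orP; right.
  by case: (posnP a) => [->|a_gt0]; rewrite ?expn0 // leq_exp2r.
by rewrite expnMn mulnCA [(N ^ a * _)%N]mulnC ltn_pmul2r ?expn_gt0.
Qed.

(** The Koszul complex on all variables is exact in degrees less than [d];
    removing the variables outside [C] costs one degree for each of them. *)
Lemma regular_acyclic C d j r : weakly_regular I r -> size r = d ->
    (forall a, a \in r -> adjoins I (map x (enum V)) a) ->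
  (#|~: C| + j < d)%N -> acyclic I (map x (enum C)) j.
Proof.
move=> r_reg <- r_x lt_j.
have II := @face_ideal_ideal k V e set0.
apply: (@acyclic_drop _ I (fun D => trunc D : {additive R -> R})
                      (map x (enum (~: C))) _ _ II).
- move=> D p /face_idealP Ip; apply/face_idealP => m m_face.
  by rewrite mcoeff_trunc Ip ?if_same.
- by move=> D b p; rewrite -map_cat => /mapP[v _ ->]; exact: truncXU.
- exact: trunc0.
- exact: trunc_id.
rewrite size_map -cardE; apply: weakly_regular_acyclic r_reg _ lt_j => // a /r_x.
apply: adjoins_sub => [|p|b /mapP[v _ ->]]; first exact: adjoins_ideal.
  exact: sub_adjoins.
apply: mem_adjoins => //; rewrite -map_cat; apply: map_f.
by rewrite mem_cat !mem_enum !inE orNb.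
Qed.

Definition set_monomial S : 'X_{1..n} :=
  [multinom (enum_val i \in S : nat) | i < n].

Lemma vsupp_set_monomial S : vsupp (set_monomial S) = S.
Proof. by apply/setP => v; rewrite inE mnmE enum_rankK; case: (v \in S). Qed.

Lemma face_idealXU K v m p : independent e (v |: vsupp m) ->
  I (x v * p) -> p@_m = 0.
Proof.
move=> ind /face_idealP/(_ (U_(enum_rank v) + m)%MM); rewrite mul_var; apply.
by rewrite nonface0 vsuppD vsuppU ind.
Qed.

Lemma face_ideal_edge v w p : e v w -> I (x v * (x w * p)).
Proof.
have II := @face_ideal_ideal k V e set0.
move=> evw; rewrite mulrA mulrC; apply: (idealMl _ II).
rewrite -mpolyXD; apply/face_idealX; rewrite nonface0 vsuppD !vsuppU.
apply/negP => /independentP/(_ v w); rewrite !inE !eqxx orbT evw.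
by move=> /(_ isT isT).
Qed.

Lemma face_ideal_nbr S v w : w \in S -> e v w -> I (x v * 'X_[set_monomial S]).
Proof.
move=> wS evw; rewrite -mpolyXD; apply/face_idealX.
rewrite nonface0 vsuppD vsuppU vsupp_set_monomial.
apply/negP => /independentP/(_ v w); rewrite setU11 setU1r // evw.
by move=> /(_ isT isT).
Qed.

(** The monomial [x_S] is a nonzero class killed by all variables outside
    [S]. *)
Lemma depth_le_maximal_independent d r S : weakly_regular I r -> size r = d ->
    (forall a, a \in r -> adjoins I (map x (enum V)) a) ->
    independent e S -> (forall v, v \notin S -> exists2 w, w \in S & e v w) ->
  (d <= #|S|)%N.
Proof.
move=> r_reg size_r r_x indS maxS; have [//|lt_S] := leqP d #|S|.
have II := @face_ideal_ideal k V e set0.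
have ac : acyclic I (map x (enum (~: S))) 0.
  by apply: regular_acyclic r_reg size_r r_x _; rewrite setCK addn0.
suff: I 'X_[set_monomial S].
  by move/face_idealX; rewrite nonface0 vsupp_set_monomial indS.
apply: (acyclic_deg0 II ac) => v; rewrite mem_enum inE => /maxS[w wS evw].
exact: face_ideal_nbr evw.
Qed.

(** The link of [S] in the independence complex is disconnected: its vertices
    are split into neighbors of [y] and neighbors of [p], and the two
    parts are joined completely. The cocycle [phi] is multiplication by [x_S]
    on the first part and zero on the second. If it came from an element [z],
    the coefficient of [x_S] in [z] would be both [1] and [0]. *)
Lemma depth_le_disconnected d r S (p y : V) : weakly_regular I r -> size r = d ->
    (forall a, a \in r -> adjoins I (map x (enum V)) a) ->
    independent e (p |: S) -> independent e (y |: S) -> e p y ->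
    (forall w, w \notin S -> [\/ exists2 s, s \in S & e w s, e w p | e w y]) ->
    (forall v w, e v y -> e w p -> e v w) ->
  (d <= #|S|.+1)%N.
Proof.
move=> r_reg size_r r_x indSp indSy epy maxS join.
have [//|lt_S] := leqP d #|S|.+1.
have II := @face_ideal_ideal k V e set0.
have ac : acyclic I (map x (enum (~: S))) 1.
  by apply: regular_acyclic r_reg size_r r_x _; rewrite setCK addn1.
pose u : R := 'X_[set_monomial S].
have uI v w : v \notin S -> w \notin S -> e v y -> ~~ e w y ->
    I (x w * (x v * u)).
  move=> vS wS evy ewy; have [[s sS ews]|ewp|] := maxS w wS.
  - by rewrite mulrCA; apply: (idealMl _ II); apply: face_ideal_nbr sS ews.
  - by apply: face_ideal_edge; rewrite e_sym join.
  - by rewrite (negPf ewy).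
have pS : p \notin S.
  apply: contraL epy => pS; move/independentP: indSy; apply;
  by rewrite !inE ?pS ?eqxx ?orbT.
have yS : y \notin S.
  apply: contraL epy => yS; move/independentP: indSp; apply;
  by rewrite !inE ?yS ?eqxx ?orbT.
pose phi v := if e v y then x v * u else 0.
have [|z hz] := acyclic_deg1 (phi := phi) II ac; rewrite /phi.
  move=> v w; rewrite !mem_enum !inE => vS wS.
  case: ifPn => ewy; case: ifPn => evy; rewrite ?mulr0 ?subr0 ?sub0r.
  - by rewrite mulrCA subrr; apply: ideal0.
  - exact: uI.
  - by apply: (idealN II); apply: uI.
  - exact: ideal0.
have zp : (u - z)@_(set_monomial S) = 0.
  apply: (@face_idealXU set0 p); first by rewrite vsupp_set_monomial.
  by have := hz p; rewrite mem_enum inE /phi epy mulrBr => /(_ pS).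
have zy : z@_(set_monomial S) = 0.
  apply: (@face_idealXU set0 y); first by rewrite vsupp_set_monomial.
  have := hz y; rewrite mem_enum inE /phi e_irr => /(_ yS).
  by rewrite sub0r => /(idealN II); rewrite opprK.
by move: zp; rewrite mcoeffB zy subr0 mcoeffX eqxx => /eqP; rewrite oner_eq0.
Qed.

End FaceIdealBounds.

(** * Hall's marriage theorem *)
Section Hall.

Variable T : finType.
Implicit Types (A B C : {set T}) (r : T -> {set T}).

(** Induction on [A]. If some nonempty proper subset [B] is tight, match [B] and
    [A :\: B] separately, using for the latter what is left outside the
    neighborhood of [B]; otherwise any choice for one element preserves Hall's
    condition for the others. *)
Lemma hall A r : (forall B, B \subset A -> #|B| <= #|\bigcup_(v in B) r v|)%N ->
  exists f : T -> T, {in A, forall v, f v \in r v} /\ {in A &, injective f}.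
Proof.
have [m] := ubnP #|A|; elim: m A r => // m IHm A r lt_m hallA.
have [->|[a aA]] := set_0Vmem A; first by exists id; split=> v; rewrite inE.
pose N B := \bigcup_(v in B) r v.
have [/existsP[B /and4P[sBA nB0 nBA leN]]|] :=
    boolP [exists B : {set T},
             [&& B \subset A, B != set0, B != A & #|N B| <= #|B|]%N].
  have ltBA : (#|B| < #|A|)%N by apply: proper_card; rewrite properEneq nBA.
  have ltDA : (#|A :\: B| < #|A|)%N.
    rewrite -(cardsID B A) (setIidPr sBA) -[X in (X < _)%N]add0n.
    by rewrite ltn_add2r card_gt0.
  have [||f1 [f1r f1_inj]] := IHm B r.
  - exact: leq_trans ltBA lt_m.
  - by move=> C sCB; apply: hallA; apply: subset_trans sCB sBA.
  have [||f2 [f2r f2_inj]] := IHm (A :\: B) (fun v => r v :\: N B).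
  - exact: leq_trans ltDA lt_m.
  - move=> C; rewrite subsetD => /andP[sCA disCB].
    rewrite (_ : \bigcup_(v in C) _ = N (B :|: C) :\: N B); last first.
      apply/setP => w; rewrite in_setD; apply/bigcupP/andP => [[v vC]|[wNB]].
        rewrite in_setD => /andP[-> wv]; split=> //; apply/bigcupP; exists v => //.
        by rewrite inE vC orbT.
      case/bigcupP => v; rewrite inE => /orP[vB|vC] wv.
        by case/bigcupP: wNB; exists v.
      by exists v; rewrite // in_setD wNB.
    have sNB : N B \subset N (B :|: C).
      by apply/bigcupsP => v vB; apply: bigcup_sup; rewrite inE vB.
    rewrite cardsD (setIidPr sNB) leq_subRL; last exact: subset_leq_card.
    apply: leq_trans (hallA (B :|: C) _); last by rewrite subUset sBA.
    rewrite cardsU setIC (_ : C :&: B = set0); last by apply/eqP; rewrite setI_eq0.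
    by rewrite cards0 subn0 leq_add2r.
  have fN v : v \in B -> f1 v \in N B.
    by move=> vB; apply/bigcupP; exists v; rewrite ?f1r.
  have f'N v : v \in A -> v \notin B -> f2 v \notin N B.
    by move=> vA vB; have := f2r v; rewrite !inE vA vB => /(_ isT)/andP[].
  exists (fun v => if v \in B then f1 v else f2 v); split=> [v vA|v w vA wA].
    case: ifPn => vB; first exact: f1r.
    by have := f2r v; rewrite !inE vA vB => /(_ isT)/andP[].
  case: ifPn => vB; case: ifPn => wB.
  - exact: f1_inj.
  - by move=> e_vw; move: (f'N w wA wB); rewrite -e_vw fN.
  - by move=> e_vw; move: (f'N v vA vB); rewrite e_vw fN.
  - by apply: f2_inj; rewrite inE ?vB ?wB.
rewrite negb_exists => /forallP not_tight.
have [y ya] : exists y, y \in r a.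
  apply/set0Pn; rewrite -card_gt0.
  by have := hallA [set a]; rewrite sub1set cards1 big_set1; apply.
have [||f [fr f_inj]] := IHm (A :\ a) (fun v => r v :\ y).
- by move: lt_m; rewrite (cardsD1 a A) aA.
- move=> C; rewrite subsetD1 => /andP[sCA aC].
  rewrite (_ : \bigcup_(v in C) _ = N C :\ y); last first.
    apply/setP => w; rewrite in_setD1; apply/bigcupP/andP => [[v vC]|[wy]].
      by rewrite in_setD1 => /andP[-> wv]; split=> //; apply/bigcupP; exists v.
    by case/bigcupP => v vC wv; exists v; rewrite // in_setD1 wy.
  have [->|C0] := eqVneq C set0; first by rewrite cards0.
  have := not_tight C; rewrite sCA C0 /= (_ : C != A) => [|]; last first.
    by apply: contraNneq aC => ->.
  rewrite -ltnNge (cardsD1 y (N C)); case: (y \in N C) => //=.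
  by rewrite add0n => /ltnW.
exists (fun v => if v == a then y else f v); split=> [v vA|v w vA wA].
  case: eqP => [->//|/eqP va]; have := fr v; rewrite !inE va vA => /(_ isT).
  by case/andP.
have fy u : u \in A -> u != a -> f u != y.
  by move=> uA ua; have := fr u; rewrite !inE ua uA => /(_ isT)/andP[].
case: eqP => [->|/eqP va]; case: eqP => [->|/eqP wa] //.
- by move=> e_y; move: (fy w wA wa); rewrite e_y eqxx.
- by move=> e_y; move: (fy v vA va); rewrite e_y eqxx.
- by apply: f_inj; rewrite !inE ?va ?wa.
Qed.

End Hall.

(** * Perfect matchings of very well-covered graphs *)
Section WellCovered.

Variables (V : finType) (e : rel V).
Hypotheses (e_sym : symmetric e) (e_irr : irreflexive e).
Implicit Types (S T U W : {set V}).

Lemma vertex_coverE (C : {set V}) : vertex_cover e C = independent e (~: C).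
Proof.
apply/forallP/independentP => [cov v w|ind v].
  rewrite !inE => vC wC; apply/negP => evw.
  by have /forallP/(_ w) := cov v; rewrite evw (negPf vC) (negPf wC).
apply/forallP => w; apply/implyP => evw; rewrite -[_ || _]negbK negb_or.
by apply/negP => /andP[vC wC]; move: (ind v w); rewrite !inE evw => /(_ vC wC).
Qed.

Lemma minimal_vertex_coverE (C : {set V}) :
  minimal_vertex_cover e C = maxset (independent e) (~: C).
Proof.
rewrite maxminset setCK; apply: minset_eq => B /=.
by rewrite vertex_coverE.
Qed.

Lemma maximal_independent_nbr S v : maxset (independent e) S -> v \notin S ->
  exists2 w, w \in S & e v w.
Proof.
move=> /maxsetP[indS maxS] vS.
have [dis|/pred0Pn[w /=]] := boolP [disjoint S & nbhd e v].
  case/negP: vS; rewrite -(maxS (v |: S)) ?setU11 ?subsetUr //.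
  by rewrite independentU1 // indS.
by rewrite inE => /andP[wS evw]; exists w.
Qed.

Definition nbhds T : {set V} := \bigcup_(v in T) nbhd e v.

Variable n : nat.
Hypothesis well_covered : forall S, maxset (independent e) S -> #|S| = n.

Lemma independent_extend S : independent e S ->
  exists2 W : {set V}, S \subset W & maxset (independent e) W.
Proof. by case/maxset_exists => W maxW sSW; exists W. Qed.

Lemma independent_card S : independent e S -> (#|S| <= n)%N.
Proof.
by case/independent_extend => W sSW /well_covered <-; apply: subset_leq_card.
Qed.

Hypothesis no_isolated : forall v, exists w, e v w.

(** By induction on [T]. Take [U] maximal among the independent subsets of
    [nbhds T], and let [T'] be the part of [T] not adjacent to [U]. Exchanging
    [U] for [T :\: T'] in a maximal independent set containing [U] and [T']
    gives [#|T :\: T'| <= #|U|], while the neighbors of [T'] avoid [U]; so a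
    counterexample [T] would yield the smaller counterexample [T']. *)
Lemma independent_expands T : independent e T -> (#|T| <= #|nbhds T|)%N.
Proof.
have [m] := ubnP #|T|; elim: m T => // m IHm T lt_m indT.
have mem_nbhds t v : t \in T -> e t v -> v \in nbhds T.
  by move=> tT etv; apply/bigcupP; exists t; rewrite ?inE.
pose P U := independent e U && (U \subset nbhds T).
have P0 : P set0 by rewrite /P sub0set andbT; apply/independentP => v; rewrite inE.
have [U /maxsetP[/andP[indU sUN] maxU] _] := maxset_exists P0.
pose T' := T :\: nbhds U.
have T'U v w : v \in T' -> w \in U -> ~~ e v w.
  rewrite inE => /andP[vNU _] wU; apply: contra vNU => evw.
  by apply/bigcupP; exists w; rewrite // inE e_sym.
have indUT' : independent e (U :|: T').
  apply/independentP => v w; rewrite !in_setU => /orP[vU|vT'] /orP[wU|wT'].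
  - exact: (independentP _ _ indU).
  - by rewrite e_sym T'U.
  - exact: T'U.
  - move: vT' wT'; rewrite !in_setD => /andP[_ vT] /andP[_ wT].
    exact: (independentP _ _ indT).
have [W sUW maxW] := independent_extend indUT'.
have /maxsetP[indW _] := maxW.
have /subsetP sUW' : U \subset W by apply: subset_trans sUW; apply: subsetUl.
have WN : W :&: nbhds T = U.
  apply: maxU; last by rewrite subsetI sUN andbT; apply/subsetP.
  by rewrite /P subsetIr andbT; apply: independent_sub indW; apply: subsetIl.
have TW : T :&: W = T'.
  apply/setP => t; rewrite !inE; apply/andP/andP => [[tT tW]|[tNU tT]]; split=> //.
    apply/bigcupP => -[u uU]; rewrite inE => eut.
    by move/independentP: indW => /(_ u t (sUW' u uU) tW); rewrite eut.
  by apply: (subsetP sUW); rewrite !inE tNU tT orbT.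
have indTW : independent e (T :|: (W :\: nbhds T)).
  apply/independentP => v w; rewrite !in_setU !in_setD.
  move=> /orP[vT|/andP[vN vW]] /orP[wT|/andP[wN wW]].
  - exact: (independentP _ _ indT).
  - by apply: contra wN; apply: mem_nbhds.
  - by rewrite e_sym; apply: contra vN; apply: mem_nbhds.
  - exact: (independentP _ _ indW).
have TN : T :&: nbhds T = set0.
  apply/setP => t; rewrite !inE; apply/andP => -[tT /bigcupP[s sT]].
  by rewrite inE => est; move/independentP: indT => /(_ s t sT tT); rewrite est.
have le_TU : (#|T| <= #|T'| + #|U|)%N.
  have := independent_card indTW; rewrite -(well_covered maxW).
  rewrite cardsU setIDA TW cardsD WN (_ : T' :\: nbhds T = T'); last first.
    apply/setDidPl; rewrite -setI_eq0; apply/eqP.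
    by rewrite -TW setIAC TN set0I.
  have := subset_leq_card (subsetIr T W); rewrite TW.
  have : (#|U| <= #|W|)%N by apply/subset_leq_card/subsetP.
  by lia.
have le_N : (#|nbhds T'| + #|U| <= #|nbhds T|)%N.
  have dis : nbhds T' :&: U = set0.
    apply/setP => u; rewrite !inE; apply/andP => -[/bigcupP[t tT']].
    by rewrite inE => etu uU; move: (T'U t u tT' uU); rewrite etu.
  rewrite -[X in (X <= _)%N]subn0 -(cards0 V) -dis -cardsU; apply: subset_leq_card.
  rewrite subUset sUN andbT; apply/bigcupsP => t; rewrite inE => /andP[_ tT].
  exact: bigcup_sup.
have [T0|[t tT]] := set_0Vmem T; first by rewrite T0 cards0.
have lt_T' : (#|T'| < #|T|)%N.
  have [w etw] := no_isolated t.
  have wN := mem_nbhds t w tT etw.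
  have [u uU] : exists u, u \in U.
    apply/set0Pn; apply: contraTneq wN => U0.
    have := maxU [set w]; rewrite U0 sub0set /P => h.
    apply/negP => wN; have /setP/(_ w) : [set w] = set0.
      apply: h => //; rewrite sub1set wN andbT; apply/independentP => v v'.
      by rewrite !inE => /eqP-> /eqP->; rewrite e_irr.
    by rewrite !inE eqxx.
  have /bigcupP[s sT] := subsetP sUN u uU; rewrite inE => esu.
  apply: proper_card; rewrite properE subsetDl; apply/subsetPn; exists s => //.
  by rewrite !inE sT andbT negbK; apply/bigcupP; exists u; rewrite // inE e_sym.
have : (#|T'| <= #|nbhds T'|)%N.
  apply: IHm; first exact: leq_trans lt_T' lt_m.
  by apply: independent_sub indT; apply: subsetDl.
by lia.
Qed.

Hypothesis card_V : #|V| = (2 * n)%N.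

(** Hall's theorem matches a maximal independent set [S] into its complement,
    which has the same number [n] of elements. *)
Lemma perfect_matching : exists mu : V -> V, involutive mu /\ forall v, e v (mu v).
Proof.
have ind0 : independent e set0 by apply/independentP => v; rewrite inE.
have [S _ maxS] := independent_extend ind0.
have /maxsetP[indS _] := maxS.
have [B sBS|f [f_nbr f_inj]] := @hall _ S (nbhd e).
  by apply: independent_expands; apply: independent_sub indS.
have ef v : v \in S -> e v (f v) by move=> /f_nbr; rewrite inE.
have fS v : v \in S -> f v \notin S.
  move=> vS; apply/negP => fvS.
  by move/independentP: indS => /(_ v (f v) vS fvS); rewrite ef.
have f_onto w : w \notin S -> exists2 v, v \in S & f v = w.
  have fSC : f @: S = ~: S.
    apply/eqP; rewrite eqEcard; apply/andP; split.
      by apply/subsetP => _ /imsetP[v vS ->]; rewrite inE fS.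
    rewrite cardsCs setCK card_V (card_in_imset f_inj) (well_covered maxS).
    by rewrite mul2n -addnn addnK.
  move=> wS; have : w \in f @: S by rewrite fSC inE.
  by case/imsetP => v vS ->; exists v.
pose g w := odflt w [pick v in S | f v == w].
have gP w : w \notin S -> g w \in S /\ f (g w) = w.
  move=> wS; rewrite /g; case: pickP => [v /andP[vS /eqP<-]//|none] /=.
  by have [v vS fv] := f_onto w wS; have := none v; rewrite vS fv eqxx.
exists (fun v => if v \in S then f v else g v); split=> v.
  rewrite /=; have [vS|vS] := boolP (v \in S).
    by rewrite (negPf (fS v vS)); have [gS /f_inj->] := gP _ (fS v vS).
  by have [-> ->] := gP v vS.
rewrite /=; case: ifPn => vS; first exact: ef.
by have [gS fg] := gP v vS; rewrite -[X in e X _]fg e_sym ef.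
Qed.

(** Otherwise [z] and [w] lie in a maximal independent set [W], which contains
    neither [v] nor [mu v]. But [W] has [n] elements and at most one in each of
    the [n] matching edges, so it meets all of them. *)
Lemma matching_edge_join (mu : V -> V) v z w :
  involutive mu -> (forall v, e v (mu v)) ->
  e z v -> e w (mu v) -> e z w.
Proof.
move=> muK e_mu ezv ewv; apply/negPn/negP => ezw.
have ind : independent e [set z; w].
  apply/independentP => a b; rewrite !inE.
  move=> /orP[]/eqP-> /orP[]/eqP->; rewrite ?e_irr //.
  by rewrite e_sym.
have [W /subsetP sW maxW] := independent_extend ind.
have /maxsetP[/independentP indW _] := maxW.
have zW : z \in W by rewrite sW // !inE eqxx.
have wW : w \in W by rewrite sW // !inE eqxx orbT.
have dis : W :&: mu @: W = set0.
  apply/setP => a; rewrite !inE; apply/andP => -[aW /imsetP[b bW a_b]].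
  by move: (indW _ _ bW aW); rewrite a_b e_mu.
have WT : W :|: mu @: W = setT.
  apply/eqP; rewrite eqEcard subsetT cardsT card_V cardsU dis cards0 subn0.
  by rewrite (card_imset _ (inv_inj muK)) (well_covered maxW) mul2n addnn /=.
have : v \in W :|: mu @: W by rewrite WT inE.
rewrite inE => /orP[vW|/imsetP[b bW v_b]].
  by move: (indW _ _ zW vW); rewrite ezv.
by move: (indW _ _ wW bW); rewrite -(muK b) -v_b ewv.
Qed.

End WellCovered.

(** * A regular sequence for twin-free very well-covered graphs *)
Section MatchingRegular.

Variables (k : fieldType) (V : finType) (e : rel V).
Hypotheses (e_sym : symmetric e) (e_irr : irreflexive e).
Variable mu : V -> V.
Hypotheses (muK : involutive mu) (e_mu : forall v, e v (mu v)).
Hypothesis join : forall v z w, e z v -> e w (mu v) -> e z w.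
Local Notation R := {mpoly k[#|V|]}.
Local Notation x := (@var k V).
Local Notation I := (@face_ideal k V e).
Implicit Types (K : {set V}) (l : seq V).

Definition edge_diff (v : V) : R := x v - x (mu v).

(** Modulo [x (mu a)] the difference is [x a] up to sign, and [x a] is regular
    because the neighbors of [a] are killed already. *)
Lemma edge_diff_step K v a :
    (a == v) || (a == mu v) -> a \notin K -> mu a \in K -> nbhd e a \subset K ->
  (forall g, I K (edge_diff v * g) -> I K g) /\
  adjoin (I K) (edge_diff v) = I (a |: K).
Proof.
move=> a_v aK muaK nbr_a; have IK := @face_ideal_ideal k V e K.
have IKmu : I K (x (mu a)) by apply: face_ideal_var.
have reg_a g : I K (x a * g) -> I K g.
  have := colon_face_ideal k e_sym e_irr aK; rewrite (setUidPl nbr_a) => E.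
  by move=> Iag; rewrite -E.
(* the sign depends on which end of the matching edge [a] is *)
have [s def_diff] : exists s : bool, I K ((-1) ^+ s * edge_diff v - x a).
  case/orP: a_v => /eqP a_v; [exists false | exists true].
    rewrite expr0 mul1r /edge_diff -a_v addrAC subrr sub0r.
    exact: (idealN IK).
  rewrite expr1 mulN1r /edge_diff opprB a_v addrAC subrr sub0r -[v]muK -a_v.
  exact: (idealN IK).
split=> [g Ig|].
  apply: reg_a; have -> : x a * g =
    (-1) ^+ s * (edge_diff v * g) - g * ((-1) ^+ s * edge_diff v - x a) by ring.
  by apply: (idealB IK); apply: (idealMl _ IK).
rewrite -adjoin_face_ideal // -(adjoin_congr IK def_diff).
by case: s {def_diff}; rewrite ?expr0 ?expr1 ?mul1r ?mulN1r ?adjoinN.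
Qed.

(** When the variables of [K] cover all edges and contain one end of each
    matching edge of [l], the quotient is a polynomial ring in which the
    differences are variables up to sign. *)
Lemma edge_diffs_regular_base K l : uniq l -> {in l, forall v, mu v \notin l} ->
    {in l, forall v, (v \in K) (+) (mu v \in K)} ->
    (forall v, v \notin K -> nbhd e v \subset K) ->
  weakly_regular (I K) (map edge_diff l).
Proof.
elim: l K => //= v l IHl K /andP[vl uniq_l] mu_l one_K iso_K.
have [a a_v [aK muaK]] :
    exists2 a, (a == v) || (a == mu v) & a \notin K /\ mu a \in K.
  have := one_K v (mem_head _ _); case: (boolP (v \in K)) => vK /= muvK.
    by exists (mu v); rewrite ?eqxx ?orbT ?muK.
  by exists v; rewrite ?eqxx.
have [reg_v adj_v] := edge_diff_step a_v aK muaK (iso_K a aK).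
split=> //; rewrite adj_v; apply: IHl => // [w wl|w wl|w].
- have := mu_l w; rewrite !inE wl orbT => /(_ isT).
  by rewrite negb_or => /andP[].
- have w_vl : w \in v :: l by rewrite inE wl orbT.
  rewrite !in_setU1.
  have wv : w != v by apply: contraNneq vl => <-.
  have muwv : mu w != v.
    by apply: contraNneq (mu_l w w_vl) => ->; rewrite mem_head.
  have mu_eq := inj_eq (inv_inj muK).
  have wa : w != a by case/orP: a_v => /eqP->; rewrite // -mu_eq muK.
  have muwa : mu w != a by case/orP: a_v => /eqP->; rewrite // mu_eq.
  rewrite (negPf wa) (negPf muwa).
  exact: one_K.
rewrite in_setU1 negb_or => /andP[_ /iso_K] /subset_trans; apply.
exact: subsetUr.
Qed.

Hypothesis no_twins : twin_free e.

(** The quotients met in the induction: killing a vertex [v] always comes with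
    killing the neighbors of its partner [mu v], which is left as a free
    variable. *)
Definition matched_killing K : Prop :=
  {in K, forall v, mu v \notin K /\ nbhd e (mu v) \subset K}.

(** Induction on the number of matching edges not met by [K]. Among their ends
    choose [v] with the fewest neighbors. If [v] had a neighbor [y] outside [K]
    other than [mu v], then [nbhd e (mu y)] would be contained in [nbhd e v], and
    minimality would make [mu y] and [v] twins. Hence [v] becomes free when
    [mu v] is killed, and [mu v] becomes free when its neighbors are killed;
    [weakly_regular_colon] combines the two cases. *)
Lemma edge_diffs_regular K l : uniq l -> {in l, forall v, mu v \notin l} ->
  matched_killing K -> weakly_regular (I K) (map edge_diff l).
Proof.
move=> uniq_l mu_l; pose alive K := [set v | (v \notin K) && (mu v \notin K)].
have [m] := ubnP #|alive K|; elim: m K => // m IHm K lt_m killK.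
have [K_all|[v0 v0K]] := set_0Vmem (alive K).
  apply: edge_diffs_regular_base => // [v _|v vK]; last first.
    have : v \notin alive K by rewrite K_all inE.
    by rewrite inE vK /= negbK => /killK[]; rewrite muK.
  have [vK|vK] /= := boolP (v \in K); first by have [] := killK v vK.
  have : v \notin alive K by rewrite K_all inE.
  by rewrite inE vK /= negbK.
case: (arg_minnP (P := [in alive K]) (fun v => #|nbhd e v|) v0K).
move=> v v_alive min_v.
have /andP[vK muvK] : (v \notin K) && (mu v \notin K).
  by move: v_alive; rewrite in_set.
have nbr_v : nbhd e v \subset mu v |: K.
  apply/subsetP => y; rewrite inE in_setU1 => evy.
  have [//|yK] := boolP (y \in K); first by rewrite orbT.
  rewrite orbF; apply/negPn/negP => ymuv.
  have muyK : mu y \notin K.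
    apply/negP => /killK[_]; rewrite muK => /subsetP/(_ v).
    by rewrite inE e_sym evy (negPf vK) => /(_ isT).
  have sub_nbr : nbhd e (mu y) \subset nbhd e v.
    apply/subsetP => z; rewrite !inE => emuyz.
    rewrite e_sym; apply: (join (v := mu y)); first by rewrite e_sym.
    by rewrite muK.
  have eq_nbr : nbhd e (mu y) = nbhd e v.
    by apply/eqP; rewrite eqEcard sub_nbr min_v // inE muyK muK yK.
  apply: (no_twins (x := mu y) (y := v)); split=> [muy_v|z].
    by case/eqP: ymuv; rewrite -muy_v muK.
  by have /setP/(_ z) := eq_nbr; rewrite !inE.
have killed_sub K' : K \subset K' -> v \notin alive K' -> (#|alive K'| < m)%N.
  move=> /subsetP sKK' v_dead; apply: (@leq_trans #|alive K|) => //.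
  apply: proper_card; rewrite properE; apply/andP; split; last first.
    by apply/subsetPn; exists v.
  by apply/subsetP => w; rewrite !inE => /andP[wK' muwK'];
    rewrite (contra (sKK' _) wK') (contra (sKK' _) muwK').
apply: (weakly_regular_colon (y := x (mu v))); first exact: face_ideal_ideal.
  rewrite colon_face_ideal //; apply: IHm.
    by apply: killed_sub; rewrite ?subsetUl // !inE e_sym e_mu orbT.
  move=> w; rewrite !inE => /orP[wK|ew].
    have [muwK nbr_w] := killK w wK; rewrite negb_or muwK; split=> /=.
      by apply: contra muvK => emu; apply: (subsetP nbr_w); rewrite inE e_sym.
    by apply: subset_trans nbr_w _; apply: subsetUl.
  split.
    rewrite negb_or; apply/andP; split.
      apply: contra muvK => /killK[_]; rewrite muK => /subsetP; apply.
      by rewrite inE e_sym.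
    apply/negP => emuw; move: (e_irr (mu v)).
    by rewrite (join (v := w) ew emuw).
  apply/subsetP => u; rewrite !inE => euw; apply/orP; right.
  by apply: (join (v := w)); rewrite // e_sym.
rewrite adjoin_face_ideal //; apply: IHm.
  by apply: killed_sub; rewrite ?subsetUr // !inE eqxx andbF.
move=> w; rewrite in_setU1 => /orP[/eqP->|wK].
  rewrite muK in_setU1 negb_or vK nbr_v andbT; split=> //.
  by apply: contraTneq (e_mu v) => <-; rewrite e_irr.
have [muwK nbr_w] := killK w wK; rewrite in_setU1 negb_or muwK andbT; split.
  by apply: contraNneq vK => /(inv_inj muK) <-.
by apply: subset_trans nbr_w _; apply: subsetUr.
Qed.

End MatchingRegular.

(** * From the polynomial ring to the edge ring *)
Section EdgeRing.

Variables (k : fieldType) (V : finType) (e : rel V).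
Hypotheses (e_sym : symmetric e) (e_irr : irreflexive e).
Local Notation R := {mpoly k[#|V|]}.
Local Notation x := (@var k V).
Local Notation I := (@face_ideal k V e set0).
Local Notation A := (edge_ring k e).
Implicit Types (S C W : {set V}) (f g : R).

Definition proj : R -> A := \pi_({ideal_quot (@edge_ideal k V e)})%qT.

Lemma proj_eq f g : proj f = proj g <-> I (f - g).
Proof.
rewrite face_ideal_edges //.
split=> [/eqP|Ifg].
  by rewrite -Quotient.idealrBE => /asboolP.
by apply/eqP; rewrite -Quotient.idealrBE; apply/asboolP.
Qed.

Lemma projD f g : proj (f + g) = proj f + proj g.
Proof. exact: rmorphD. Qed.

Lemma projM f g : proj (f * g) = proj f * proj g.
Proof. exact: rmorphM. Qed.

Lemma proj_zero : proj 0 = 0. Proof. exact: rmorph0. Qed.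
Lemma proj_one : proj 1 = 1. Proof. exact: rmorph1. Qed.

Definition lift (a : A) : R := repr a.

Lemma liftK a : proj (lift a) = a. Proof. exact: reprK. Qed.

Definition pullback (L : set A) : set R := [set f | L (proj f)].

Lemma pullback_ideal (L : set A) : is_ideal L -> is_ideal (pullback L).
Proof.
move=> LI; split=> [|f g|r f]; rewrite /pullback /=.
- by rewrite proj_zero; apply: ideal0 LI.
- by rewrite projD; apply: idealD LI.
- by rewrite projM; apply: idealMl LI.
Qed.

Lemma sub_pullback (L : set A) f : is_ideal L -> I f -> pullback L f.
Proof.
move=> LI If; rewrite /pullback /= (_ : proj f = proj 0).
  by rewrite proj_zero; apply: ideal0 LI.
by apply/proj_eq; rewrite subr0.
Qed.

Lemma adjoins_lift_ideal r : is_ideal [set a | adjoins I r (lift a)].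
Proof.
have II := @face_ideal_ideal k V e set0; have rI := adjoins_ideal r II.
have lift_proj f : I (lift (proj f) - f) by apply/proj_eq; rewrite liftK.
have proj_in f : adjoins I r f -> adjoins I r (lift (proj f)).
  move=> rf; rewrite -(subrK f (lift _)); apply: (idealD rI) => //.
  exact: sub_adjoins.
split=> [|a b ra rb|c a ra] /=.
- by rewrite -proj_zero; apply: proj_in; apply: ideal0.
- by rewrite -(liftK a) -(liftK b) -projD; apply: proj_in; apply: (idealD rI).
- by rewrite -(liftK a) -(liftK c) -projM; apply: proj_in; apply: (idealMl _ rI).
Qed.

Lemma proj_ideal_gen r f :
  ideal_gen [set` map proj r]%classic (proj f) <-> adjoins I r f.
Proof.
have II := @face_ideal_ideal k V e set0; have rI := adjoins_ideal r II.
have lift_proj g : I (g - lift (proj g)) by apply/proj_eq; rewrite liftK.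
split=> [gen_f|].
  rewrite -(subrK (lift (proj f)) f); apply: (idealD rI).
    exact: sub_adjoins.
  apply: (ideal_gen_sub (adjoins_lift_ideal r) _ gen_f) => _ /= /mapP[g gr ->].
  rewrite -(subKr g (lift _)); apply: (idealB rI); first exact: mem_adjoins.
  exact: sub_adjoins.
have genI := ideal_gen_ideal [set` map proj r]%classic.
apply: (adjoins_sub (pullback_ideal genI)) => [g|g gr].
  exact: sub_pullback.
by apply: ideal_gen_mem; apply: map_f.
Qed.

Lemma regular_seq_proj r :
  regular_seq (map proj r) <-> weakly_regular I r /\ ~ adjoins I r 1.
Proof.
rewrite /regular_seq -proj_one proj_ideal_gen size_map weakly_regularP.
split=> -[reg ?]; split=> // i lt_i.
  move=> g rg; apply/proj_ideal_gen; rewrite map_take; apply: reg => //.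
  by rewrite -map_take (nth_map 0) // -projM; apply/proj_ideal_gen.
move=> a; rewrite -map_take -(liftK a) (nth_map 0) // -projM.
by move=> /proj_ideal_gen/reg; rewrite proj_ideal_gen; apply.
Qed.

Lemma irrelevant_lift a : irrelevant_ideal (k := k) (e := e) a ->
  adjoins I (map x (enum V)) (lift a).
Proof.
have II := @face_ideal_ideal k V e set0.
move: a; apply: (ideal_gen_sub (adjoins_lift_ideal _)) => _ [v ->] /=.
have lift_proj g : I (g - lift (proj g)) by apply/proj_eq; rewrite liftK.
have rI := adjoins_ideal (map x (enum V)) II.
rewrite -[lift _](subKr (x v)); apply: (idealB rI).
  by apply: mem_adjoins; rewrite ?map_f ?mem_enum.
by apply: sub_adjoins; exact: (lift_proj (x v)).
Qed.

Lemma weakly_regular_chain r : weakly_regular I r -> ~ adjoins I r 1 ->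
  regular_chain (size r) (fun i => adjoins I (take i r)) (fun i => r`_i).
Proof.
have II := @face_ideal_ideal k V e set0.
have take_rcons i : (i < size r)%N ->
    adjoins I (take i.+1 r) = adjoin (adjoins I (take i r)) r`_i.
  by move=> lt_i; rewrite (take_nth 0) // /adjoins foldl_rcons.
have rI i := adjoins_ideal (take i r) II.
move=> /weakly_regularP reg r1; split=> [i _|i lt_i|i lt_i|i|].
- exact: rI.
- by rewrite take_rcons // => f; apply: sub_adjoin.
- by rewrite take_rcons //; apply: mem_adjoin.
- exact: reg.
- by rewrite take_size.
Qed.

Lemma prime_chain_regular d (P : nat -> prime_idealr A) : prime_chain d P ->
  exists h, regular_chain d (fun i => pullback [set a | a \in P i]) h.
Proof.
move=> chainP.
have [a Pa] : exists a : nat -> A, forall i, (i < d)%N ->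
    a i \in P i.+1 /\ a i \notin P i.
  have [] := @choice _ _ (fun i b => (i < d)%N -> b \in P i.+1 /\ b \notin P i).
    move=> i; have [lt_i|_] := boolP (i < d)%N; last by exists 0.
    by have [_ [b ? ?]] := chainP i lt_i; exists b.
  by move=> a Pa; exists a.
exists (lift \o a); split=> [i _|i lt_i|i lt_i|i lt_i|].
- exact/pullback_ideal/prime_ideal_is_ideal.
- by move=> f; apply: (proj1 (chainP i lt_i)).
- by rewrite /pullback /= liftK; case: (Pa i lt_i).
- move=> f; rewrite /pullback /= projM liftK prime_idealrM.
  by case: (Pa i lt_i) => _ /negPf->.
- by rewrite /pullback /= proj_one idealr1.
Qed.

(** The prime generated by the variables of a vertex cover [W] is the kernel of
    the substitution [x_v := 0] for [v] in [W]; it contains [I] because [W] meets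
    all edges. *)
Section CoverPrime.

Variable W : {set V}.

Definition eval_out : R -> R :=
  mmap (@mpolyC #|V| k)
       (fun i : 'I_#|V| => if enum_val i \in W then 0 else 'X_i : R).

HB.instance Definition _ := GRing.RMorphism.on eval_out.

Lemma eval_out_var v : eval_out (x v) = if v \in W then 0 else x v.
Proof. by rewrite /eval_out /var mmapX mmap1U enum_rankK. Qed.

Lemma eval_outC c : eval_out c%:MP = c%:MP.
Proof. exact: mmapC. Qed.

Hypothesis covW : vertex_cover e W.

Lemma eval_out_edge f : I f -> eval_out f = 0.
Proof.
rewrite face_ideal_edges // => -[s s_edge ->].
rewrite rmorph_sum big_seq big1 // => p /s_edge[v [w [evw ->]]].
rewrite !rmorphM /= !eval_out_var.
have /forallP/(_ v)/forallP/(_ w)/implyP/(_ evw) := covW.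
by case/orP => ->; rewrite ?mul0r ?mulr0.
Qed.

Definition cover_prime (c : vertex_cover e W) : A -> bool :=
  fun a => eval_out (lift a) == 0.

Lemma cover_primeE f : (proj f \in cover_prime covW) = (eval_out f == 0).
Proof.
have /eval_out_edge : I (lift (proj f) - f) by apply/proj_eq; rewrite liftK.
rewrite rmorphB /= => /eqP; rewrite subr_eq0 => /eqP e_f.
by rewrite unfold_in /cover_prime e_f.
Qed.

Lemma cover_prime_idealr : idealr_closed (cover_prime covW).
Proof.
split.
- by rewrite -proj_zero cover_primeE rmorph0.
- by rewrite -proj_one cover_primeE rmorph1 oner_eq0.
move=> a b c; rewrite -(liftK a) -(liftK b) -(liftK c) -projM -projD.
rewrite !cover_primeE rmorphD rmorphM /= => /eqP-> /eqP->.
by rewrite mulr0 addr0.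
Qed.

Lemma cover_prime_prime : prime_idealr_closed (cover_prime covW).
Proof.
move=> a b; rewrite -(liftK a) -(liftK b) -projM !cover_primeE.
by rewrite rmorphM /= mulf_eq0.
Qed.

HB.instance Definition _ :=
  isIdealr.Build A (cover_prime covW) cover_prime_idealr.
HB.instance Definition _ :=
  isPrimeIdealrClosed.Build A (cover_prime covW) cover_prime_prime.

Definition cover_prime_ideal : prime_idealr A := cover_prime covW.

End CoverPrime.

Lemma eval_out_sub W W' f : W \subset W' ->
  eval_out W' (eval_out W f) = eval_out W' f.
Proof.
move=> /subsetP sWW'.
have evalE U : eval_out U f =
    \sum_(m <- msupp f) (f@_m)%:MP * \prod_i eval_out U 'X_i ^+ m i.
  rewrite {1}/eval_out {1}/mmap; apply: eq_bigr => m _; congr (_ * _).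
  by apply: eq_bigr => i _; rewrite /eval_out mmapX mmap1U.
rewrite (evalE W) (evalE W') rmorph_sum; apply: eq_bigr => m _.
rewrite rmorphM rmorph_prod /= eval_outC; congr (_ * _).
apply: eq_bigr => i _; rewrite rmorphXn; congr (_ ^+ _).
rewrite -(enum_valK i) (eval_out_var W); case: ifP => // vW.
by rewrite eval_out_var sWW' // rmorph0.
Qed.

(** Add the vertices of [S] one by one to the cover [~: S]. *)
Lemma cover_prime_chain S : independent e S ->
  exists P : nat -> prime_idealr A, prime_chain #|S| P.
Proof.
move=> indS; pose W i : {set V} := ~: S :|: [set v in take i (enum S)].
have covW i : vertex_cover e (W i).
  rewrite vertex_coverE; apply: independent_sub indS.
  by rewrite setCU setCK subsetIl.
exists (fun i => cover_prime_ideal (covW i)) => i lt_i.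
have lt_size : (i < size (enum S))%N by rewrite -cardE.
have [v0 _] : exists v, v \in S by apply/set0Pn; rewrite -card_gt0; lia.
have def_take := take_nth v0 lt_size.
split=> [a|].
  rewrite -(liftK a) !cover_primeE => /eqP ev0.
  rewrite -(@eval_out_sub (W i)) ?ev0 ?rmorph0 //.
  apply/setUS/subsetP => v; rewrite !inE def_take mem_rcons inE => ->.
  by rewrite orbT.
pose v := nth v0 (enum S) i; exists (proj (x v)); rewrite cover_primeE eval_out_var.
  by rewrite !inE def_take mem_rcons mem_head orbT.
have vS : v \in S by rewrite -mem_enum mem_nth.
rewrite !inE vS /= ifN.
  by rewrite -msize_poly_eq0 /var msizeX.
apply/negP => /(nthP v0)[j]; rewrite size_take lt_size => lt_j.
rewrite nth_take // => /eqP; rewrite nth_uniq ?enum_uniq //.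
  by rewrite (ltn_eqF lt_j).
exact: ltn_trans lt_size.
Qed.

Lemma has_depth_regular d : has_depth (irrelevant_ideal (k := k) (e := e)) d ->
  exists2 r, weakly_regular I r & size r = d /\
    forall a, a \in r -> adjoins I (map x (enum V)) a.
Proof.
move=> [[t [reg_t t_irr size_t]] _]; exists (map (@lift) t).
  apply: (proj1 (proj1 (regular_seq_proj _) _)).
  by rewrite -map_comp map_id_in // => a _; apply: liftK.
split; first by rewrite size_map.
by move=> _ /mapP[a /t_irr + ->]; apply: irrelevant_lift.
Qed.

(** Every maximal independent set bounds the depth from above and the dimension
    from below, so it has exactly [d] elements. *)
Lemma Cohen_Macaulay_depth : Cohen_Macaulay k e -> exists r,
  [/\ weakly_regular I r, forall a, a \in r -> adjoins I (map x (enum V)) a &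
      forall S, maxset (independent e) S -> #|S| = size r].
Proof.
case=> d [/has_depth_regular[r r_reg [<- r_x]] [_ dim_le]].
exists r; split=> // S maxS.
have /maxsetP[indS _] := maxS; have [P chainP] := cover_prime_chain indS.
apply/eqP; rewrite eqn_leq (dim_le _ _ chainP) /=.
apply: depth_le_maximal_independent r_reg erefl r_x indS _ => //.
by move=> v; apply: maximal_independent_nbr.
Qed.

Variable n : nat.
Hypothesis card_V : #|V| = (2 * n)%N.
Hypothesis no_isolated : forall v, exists w, e v w.

(** With [y] the partner of [p] and [S] maximal for the independence of
    both [p |: S] and [y |: S], the twins make [S] at least two elements smaller
    than [n], whereas [depth_le_disconnected] allows a gap of one only. *)
Lemma Cohen_Macaulay_twin_free r :
    weakly_regular I r -> (forall a, a \in r -> adjoins I (map x (enum V)) a) ->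
    (forall S, maxset (independent e) S -> #|S| = n) -> (n <= size r)%N ->
  twin_free e.
Proof.
move=> r_reg r_x wc le_n p q [pq e_pq].
have [mu [muK e_mu]] := perfect_matching e_sym e_irr wc no_isolated card_V.
have join := matching_edge_join e_sym e_irr wc card_V muK e_mu.
pose y := mu p; pose P S := independent e (p |: S) && independent e (y |: S).
have P0 : P set0.
  by rewrite /P !setU0; apply/andP; split; apply/independentP => v w;
    rewrite !inE => /eqP-> /eqP->; rewrite e_irr.
have [S /maxsetP[/andP[indSp indSy] maxS] _] := maxset_exists P0.
have epy : e p y := e_mu p.
have qS : q \notin S.
  apply/negP => qS; move/independentP: indSy => /(_ q y).
  by rewrite setU11 setU1r // -e_pq epy => /(_ isT isT).
have pS : p \notin S.
  apply/negP => pS; move/independentP: indSy => /(_ p y).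
  by rewrite setU11 setU1r // epy => /(_ isT isT).
have indS2 : independent e (q |: (p |: S)).
  rewrite independentU1 // indSp; apply/pred0P => w /=.
  apply/negP => /andP[w_pS]; rewrite inE => eqw; move: w_pS.
  move/independentP: indSp => /(_ p w (setU11 _ _)) h /h.
  by rewrite e_pq eqw.
have := independent_card wc indS2.
rewrite cardsU1 in_setU1 negb_or qS eq_sym; move/eqP: (pq) => -> /=.
rewrite cardsU1 pS => le_S.
have le_r : (size r <= #|S|.+1)%N.
  apply: (depth_le_disconnected e_sym e_irr r_reg erefl r_x indSp indSy epy).
    move=> w wS; have [ewp|ewp] := boolP (e w p); first by constructor 2.
    have [ewy|ewy] := boolP (e w y); first by constructor 3.
    have [dis|/pred0Pn[s /andP[/= sS]]] := boolP [disjoint S & nbhd e w];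
      last by rewrite inE => ews; constructor 1; exists s.
    case/negP: wS; rewrite -(maxS (w |: S)) ?setU11 ?subsetUr //.
    have disU v : ~~ e w v -> [disjoint v |: S & nbhd e w].
      by rewrite -!setI_eq0 setIUl setU_eq0 !setI_eq0 disjoints1 dis andbT inE.
    rewrite /P ![_ |: (w |: S)]setUCA !(independentU1 e_sym e_irr w).
    by rewrite indSp indSy !disU.
  by move=> v w evy ewp; rewrite e_sym; exact: join ewp evy.
by have := leq_trans le_n le_r; move: le_S; lia.
Qed.

Lemma twin_free_Cohen_Macaulay :
    (forall S, maxset (independent e) S -> #|S| = n) ->
  twin_free e -> Cohen_Macaulay k e.
Proof.
move=> wc no_twins.
have [mu [muK e_mu]] := perfect_matching e_sym e_irr wc no_isolated card_V.
have join := matching_edge_join e_sym e_irr wc card_V muK e_mu.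
have chain_le d J h :
    (forall f, I f -> J 0%N f) -> regular_chain d J h -> (d <= n)%N.
  by apply: regular_chain_le => S; apply: independent_card.
have ind0 : independent e set0 by apply/independentP => v; rewrite inE.
have [S _ maxS] := independent_extend ind0.
have /maxsetP[indS _] := maxS; have card_S := wc S maxS.
pose r := map (@edge_diff k V mu) (enum S).
have r_reg : weakly_regular I r.
  apply: (edge_diffs_regular k e_sym e_irr muK e_mu join no_twins).
  - exact: enum_uniq.
  - move=> v; rewrite !mem_enum => vS; apply/negP => muvS.
    by move/independentP: indS => /(_ v (mu v) vS muvS); rewrite e_mu.
  - by move=> v; rewrite inE.
have const0 : is_ideal [set f : R | f@_0%MM = 0].
  split=> [|f g|g f] /=; first exact: mcoeff0.
    by rewrite mcoeffD => -> ->; rewrite addr0.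
  by rewrite rmorphM /= => ->; rewrite mulr0.
have var0 v : (x v)@_0%MM = 0 :> k by rewrite mcoeffX mnm1_eq0.
have r1 : ~ adjoins I r 1.
  move=> r1; suff /eqP : (1 : R)@_0%MM = 0 by rewrite mcoeff1 eqxx oner_eq0.
  apply: (adjoins_sub const0 _ _ r1) => [f /face_idealP If|_ /mapP[v _ ->]] /=.
    apply: If; rewrite nonface0 negbK (_ : vsupp _ = set0) //.
    by apply/setP => v; rewrite !inE mnm0E.
  by rewrite mcoeffB !var0 subrr.
exists n; split; split.
- exists (map (@proj) r); split.
  + exact/regular_seq_proj.
  + move=> _ /mapP[_ /mapP[v _ ->] ->]; rewrite /edge_diff /proj rmorphB.
    by apply: idealB (ideal_gen_ideal _) _ _; apply: ideal_gen_mem;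
      [exists v | exists (mu v)].
  + by rewrite !size_map -cardE.
- move=> s reg_s _.
  pose t := map (@lift) s; have [t_reg t1] : weakly_regular I t /\ ~ adjoins I t 1.
    by apply/regular_seq_proj; rewrite -map_comp map_id_in // => a _; apply: liftK.
  have := chain_le _ _ _ _ (weakly_regular_chain t_reg t1); rewrite size_map; apply.
  by move=> f; rewrite take0.
- by rewrite -card_S; apply: cover_prime_chain.
- move=> d P /prime_chain_regular[h]; apply: chain_le => f.
  exact: sub_pullback (prime_ideal_is_ideal _).
Qed.

End EdgeRing.

Theorem theorem6p3 (k : fieldType) (n : nat) (V : finType) (e : rel V)
  (e_sym : symmetric e) (e_irrefl : irreflexive e)
  (card_V : #|V| = (2 * n)%N)
  (no_isolated : forall x : V, exists y : V, e x y)
  (cover_n : exists C : {set V}, minimal_vertex_cover e C /\ #|C| = n) :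
  Cohen_Macaulay k e <-> (twin_free e /\ very_well_covered e).
Proof.
have card_setC (C : {set V}) : (#|C| + #|~: C| = 2 * n)%N by rewrite cardsC.
split=> [CM | [no_twins vwc]]; last first.
  apply: (twin_free_Cohen_Macaulay k e_sym e_irrefl card_V) => // S maxS.
  have /vwc : minimal_vertex_cover e (~: S) by rewrite minimal_vertex_coverE setCK.
  rewrite card_V; move: (card_setC S).
  by move: #|S| #|~: S| => a b; lia.
have [r [r_reg r_x card_r]] := Cohen_Macaulay_depth e_sym e_irrefl CM.
have size_r : size r = n.
  have [C [minC card_C]] := cover_n; have := card_setC C.
  by rewrite -(card_r (~: C)) -?minimal_vertex_coverE //; lia.
rewrite size_r in card_r; split=> [|C].
  by apply: Cohen_Macaulay_twin_free r_reg r_x card_r _; rewrite ?size_r.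
by rewrite minimal_vertex_coverE // => /card_r; have := card_setC C; lia.
Qed.
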